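(* Let $\Omega\subset\mathbb{R}^n$ be an $s$-regular domain with trivial cohomology, $1/2\le s\le 1$, and let $0\le k\le n$. Let $\mathcal{H}^k:\mathring{H}_h\Lambda^k(\Omega)\to Z^k$ be the generalized Hodge mapping, defined by requiring that for $u_h\in\mathring{H}_h\Lambda^k(\Omega)$ the form $\mathcal{H}^ku_h\in Z^k$ satisfies $$\mathrm{d}\mathcal{H}^ku_h=\mathrm{d}u_h,\qquad (\delta\mathcal{H}^ku_h,\delta z)=(\mathrm{d}_h^{*}u_h,\delta z)\quad\text{for all } z\in Z^k.$$ Then there is a constant $C>0$, independent of $h$ and $u_h$, such that $$\|u_h-\mathcal{H}^ku_h\|\le C h^{s}\left(\|\mathrm{d}u_h\|+\|\mathrm{d}_h^{*}u_h\|\right)\qquad\text{for all } u_h\in\mathring{H}_h\Lambda^k(\Omega).$$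
   Context: **Continuous spaces.** $\Omega\subset\mathbb{R}^n$ is a bounded domain with trivial cohomology (all Betti numbers except the zeroth vanish, so there are no nontrivial harmonic forms). $\|\cdot\|$ and $(\cdot,\cdot)$ are the $L^2$ norm and inner product of differential forms, $\|\cdot\|_s$ the norm of $H^s\Lambda^k(\Omega)$. Let $H\Lambda^k(\Omega)=\{u\in L^2\Lambda^k(\Omega):\mathrm{d}u\in L^2\Lambda^{k+1}(\Omega)\}$ with norm $\|u\|_{H\Lambda}^2=\|u\|^2+\|\mathrm{d}u\|^2$. For $0\le k\le n-1$, $\mathring{H}\Lambda^k(\Omega)$ is the subspace of forms with vanishing trace on $\partial\Omega$; $\mathring{H}\Lambda^n(\Omega)=\{q\in L^2\Lambda^n(\Omega):\int_\Omega q=0\}$. The codifferential $\delta$ on $k$-forms is given (weakly) by $\star\delta=(-1)^k\mathrm{d}\star$, with $\star$ the Hodge star, so $\delta$ is the formal adjoint of $\mathrm{d}$; $H^{*}\Lambda^k(\Omega)=\{u\in L^2\Lambda^k(\Omega):\delta u\in L^2\Lambda^{k-1}(\Omega)\}$. Let $Z^k=\mathring{H}\Lambda^k(\Omega)\cap H^{*}\Lambda^k(\Omega)$. (Operators with range or domain out of the range $0\le k\le n$ are zero.) **$s$-regularity.** $\Omega$ is $s$-regular if for every $k$ there is $C$ such that every $z\in Z^k$ lies in $H^s\Lambda^k(\Omega)$ and $\|z\|_s^2\le C(\|\mathrm{d}z\|^2+\|\delta z\|^2)$. **Discrete spaces.** For mesh sizes $h$ of a family of shape-regular meshes of $\Omega$,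 the finite element spaces $\mathring{H}_h\Lambda^k=\mathring{H}_h\Lambda^k(\Omega)\subset\mathring{H}\Lambda^k(\Omega)$, $0\le k\le n$, are finite dimensional, and $0\to\mathring{H}_h\Lambda^0\xrightarrow{\mathrm{d}}\mathring{H}_h\Lambda^1\xrightarrow{\mathrm{d}}\cdots\xrightarrow{\mathrm{d}}\mathring{H}_h\Lambda^n\to0$ is an exact complex (e.g. the standard finite element de Rham complexes: Lagrange, Nédélec, Raviart–Thomas/BDM, discontinuous polynomials, with forms of zero trace). There are projections $\Pi_k:\mathring{H}\Lambda^k(\Omega)\to\mathring{H}_h\Lambda^k$ with $\mathrm{d}\Pi_k=\Pi_{k+1}\mathrm{d}$, bounded uniformly in $h$ in the $L^2$ and $H\Lambda^k$ norms (and in $L^p$ norms on $L^p\Lambda^k(\Omega)\cap\mathring{H}\Lambda^k(\Omega)$), satisfying $\|u-\Pi_k u\|\le Ch^s\|u\|_s$ for $u\in H^s\Lambda^k(\Omega)\cap\mathring{H}\Lambda^k(\Omega)$ with $C$ independent of $h$. **Discrete codifferential.** $\mathrm{d}_h^{*}:\mathring{H}_h\Lambda^k\to\mathring{H}_h\Lambda^{k-1}$ is defined by $(\mathrm{d}_h^{*}u_h,v_h)=(u_h,\mathrm{d}v_h)$ for all $v_h\in\mathring{H}_h\Lambda^{k-1}$ ($\mathrm{d}_h^{*}=0$ for $k=0$). The conditions in the claim determine $\mathcal{H}^ku_h\in Z^k$ uniquely, i.e. $\mathcal{H}^k$ is well defined. *)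

(* Defs.v *)
From HB Require Import structures.
From mathcomp Require Import all_boot all_order all_algebra.
From mathcomp Require Import all_classical all_reals all_analysis.
Set Implicit Arguments.
Unset Strict Implicit.
Unset Printing Implicit Defensive.
Import Order.TTheory GRing.Theory Num.Theory.
Import numFieldNormedType.Exports.
Local Open Scope classical_set_scope.
Local Open Scope ring_scope.

(* The sigma-algebra on R^n generated by the coordinates, which is the Borel
   one. *)
Definition row_display : measure_display. Proof. exact: default_measure_display. Qed.

Section measurable_row.
Context {R : realType}.
Variable n : nat.

Definition row_coor (i : 'I_n) (x : 'rV[R]_n) : measurableTypeR R := x ord0 i.

Let row_set0 : g_sigma_preimage row_coor set0.
Proof. exact: sigma_algebra0. Qed.

Let row_setC A : g_sigma_preimage row_coor A -> g_sigma_preimage row_coor (~` A).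
Proof. exact: sigma_algebraC. Qed.

Let row_bigcup (F : _^nat) : (forall i, g_sigma_preimage row_coor (F i)) ->
  g_sigma_preimage row_coor (\bigcup_i (F i)).
Proof. exact: sigma_algebra_bigcup. Qed.

HB.instance Definition _ := @isMeasurable.Build row_display
  'rV[R]_n (g_sigma_preimage row_coor) row_set0 row_setC row_bigcup.

Lemma measurable_row_coor (i : 'I_n) : measurable_fun setT (row_coor i).
Proof.
move=> _ Y mY; rewrite setTI; apply: sub_sigma_algebra => /=.
rewrite -bigcup_seq/=; exists i => /=; first by rewrite mem_index_enum.
by exists Y => //; rewrite setTI.
Qed.

Lemma measurable_row_valued d (T : measurableType d) (f : T -> 'rV[R]_n) :
  (forall i, measurable_fun setT (row_coor i \o f)) -> measurable_fun setT f.
Proof.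
move=> mf _ Y mY; rewrite setTI.
pose G : set (set 'rV[R]_n) := [set A | measurable (f @^-1` A)].
suff GS : g_sigma_preimage row_coor `<=` G by apply: (GS Y mY).
apply: smallest_sub; first split.
- by rewrite /G/= preimage_set0.
- by move=> A GA; rewrite /G/= setTD preimage_setC; exact: measurableC.
- by move=> F GF; rewrite /G/= preimage_bigcup; exact: bigcupT_measurable.
rewrite -bigcup_seq => A [i _ [B mB <-]].
by rewrite /G/= setTI -comp_preimage -[X in measurable X]setTI; exact: mf.
Qed.

End measurable_row.

Section lebesgue_row.
Context {R : realType}.
Local Notation mR := (measurableTypeR R).

Definition cons_row n (p : mR * 'rV[R]_n) : 'rV[R]_n.+1 :=
  \row_i (if unlift ord0 i is Some j then p.2 ord0 j else p.1).
Definition uncons_row n (v : 'rV[R]_n.+1) : mR * 'rV[R]_n :=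
  (v ord0 ord0, \row_j v ord0 (lift ord0 j)).

Lemma measurable_cons_row n : measurable_fun setT (@cons_row n).
Proof.
apply: measurable_row_valued => i.
case: (unliftP ord0 i) => [j ->|->].
  rewrite (_ : _ \o _ = row_coor j \o snd).
    by apply: measurableT_comp => //; exact: measurable_row_coor.
  by apply/funext => p; rewrite /= /row_coor mxE liftK.
rewrite (_ : _ \o _ = fst)//.
by apply/funext => p; rewrite /= /row_coor mxE unlift_none.
Qed.

Lemma measurable_uncons_row n : measurable_fun setT (@uncons_row n).
Proof.
apply/measurable_fun_pair; first exact: measurable_row_coor.
apply: measurable_row_valued => i.
rewrite (_ : _ \o _ = row_coor (lift ord0 i)); first exact: measurable_row_coor.
by apply/funext => p; rewrite /= /row_coor mxE.
Qed.

Lemma cons_rowK n : cancel (@cons_row n) (@uncons_row n).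
Proof.
move=> [x v]; rewrite /uncons_row mxE unlift_none; congr pair.
by apply/rowP => j; rewrite !mxE liftK.
Qed.

Section step.
Variables (n : nat) (m : {sigma_finite_measure set 'rV[R]_n -> \bar R}).

Definition lebesgue_row_step : set 'rV[R]_n.+1 -> \bar R :=
  pushforward (@lebesgue_measure R \x m)%E (@cons_row n).

Let pm := measure_function_pushforward__canonical__measure_function_Measure
  (@lebesgue_measure R \x m)%E (@measurable_cons_row n).

HB.instance Definition _ := isMeasure.Build _ _ _ lebesgue_row_step
  (measure0 pm) (measure_ge0 pm) (@measure_semi_sigma_additive _ _ _ pm).

Let lebesgue_row_step_sigma_finite : sigma_finite setT lebesgue_row_step.
Proof.
have /sigma_finiteP[F [TF ndF Foo]] := sigma_finiteT (@lebesgue_measure R).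
have /sigma_finiteP[G [TG ndG Goo]] := sigma_finiteT m.
exists (fun k => @uncons_row n @^-1` (F k `*` G k)).
  rewrite -preimage_bigcup (_ : \bigcup_k _ = setT) ?preimage_setT//.
  rewrite -setXTT TF TG predeqE => -[x y]; split.
    by move=> [i _ []/= ? ?]; split; exists i.
  move=> [/= [i _ Fix] [k _ Gky]]; exists (maxn i k) => //; split.
  - by move: x Fix; exact/subsetPset/ndF/leq_maxl.
  - by move: y Gky; exact/subsetPset/ndG/leq_maxr.
move=> k; have [mF Fk] := Foo k; have [mG Gk] := Goo k; split.
  by rewrite -[X in measurable X]setTI; apply: measurable_uncons_row => //;
    exact: measurableX.
rewrite /lebesgue_row_step /pushforward -comp_preimage.
rewrite (_ : _ \o _ = id) ?preimage_id; last by apply/funext => x; exact: cons_rowK.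
by rewrite product_measure1E// lte_mul_pinfty// ge0_fin_numE.
Qed.

HB.instance Definition _ := Measure_isSigmaFinite.Build _ _ _
  lebesgue_row_step lebesgue_row_step_sigma_finite.
End step.

(* Lebesgue measure on R^n, as an iterated product. *)
Fixpoint lebesgue_row n : {sigma_finite_measure set 'rV[R]_n -> \bar R} :=
  match n with
  | 0 => \d_ (0 : 'rV[R]_0)
  | n'.+1 => lebesgue_row_step (lebesgue_row n')
  end.
End lebesgue_row.

(* Normalization: the measure of a box is the product of the side measures. *)
Lemma lebesgue_row_box {R : realType} n (A : 'I_n -> set (measurableTypeR R)) :
  (forall i, measurable (A i)) ->
  lebesgue_row n [set x : 'rV[R]_n | forall i, A i (x ord0 i)] =
  (\prod_(i < n) lebesgue_measure (A i))%E.
Proof.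
elim: n A => [|n IHn] A mA.
  by rewrite big_ord0 /= diracE mem_set// => -[].
set B := [set x : 'rV[R]_n | forall j, A (lift ord0 j) (x ord0 j)].
have mB : measurable B.
  rewrite (_ : B = \bigcap_(j in [set: 'I_n]) (row_coor j @^-1` A (lift ord0 j))).
    apply: fin_bigcap_measurable => [|j _]; first exact: finite_finset.
    by rewrite -[X in measurable X]setTI; exact: measurable_row_coor.
  apply/seteqP; split=> x Bx j; first by move=> _; exact: Bx.
  exact: (Bx j I).
rewrite big_ord_recl -IHn// -product_measure1E//=.
rewrite /lebesgue_row_step /pushforward; congr (_ _).
apply/seteqP; split => -[x v] /=.
  move=> Axv; split; first by have := Axv ord0; rewrite mxE unlift_none.
  by move=> j; have := Axv (lift ord0 j); rewrite mxE liftK.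
move=> [/= Ax Av] i; rewrite mxE; case: unliftP => [j ->|->] //.
Qed.

(* A differential form on R^n is given by its coefficients: u I is the
   coefficient of dx_I = dx_{i_1} /\ ... /\ dx_{i_k}, I = {i_1 < ... < i_k}.
   Forms may have mixed degrees; [homogeneous k] singles out the k-forms. *)
Notation dform R n := ({set 'I_n} -> 'rV[R]_n -> R).

Section domain.
Context {R : realType} {n : nat} (Omega : set 'rV[R]_n).
Local Notation mu := (@lebesgue_row R n).
Local Notation form := (dform R n).
Implicit Types (f g phi : 'rV[R]_n -> R) (u v w z : form) (I J : {set 'I_n}).

Definition bounded_domain :=
  [/\ Omega !=set0, open Omega, connected Omega & bounded_set Omega].

Definition partial (j : 'I_n) f : 'rV[R]_n -> R := fun x => 'D_(delta_mx ord0 j) f x.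

Definition smooth_on (A : set 'rV[R]_n) f :=
  forall (l : seq 'I_n) x, A x -> differentiable (foldr partial f l) x.

Definition test_function phi :=
  smooth_on setT phi /\
  exists K, [/\ compact K, K `<=` Omega & forall x, ~ K x -> phi x = 0].

Definition homogeneous (k : nat) u := forall I, #|I| != k -> u I = cst 0.

(* dx_j /\ dx_(J \ j) = sign_in j J dx_J for j in J. *)
Definition sign_in (j : 'I_n) J : R := (-1) ^+ #|[pred i in J | (i < j)%N]|.

Definition smooth_extd u : form :=
  fun J x => \sum_(j in J) sign_in j J * partial j (u (J :\ j)) x.

(* dx_I /\ dx_J = shuffle_sign I J dx_(I u J) for disjoint I and J. *)
Definition shuffle_sign I J : R :=
  (-1) ^+ #|[pred p : 'I_n * 'I_n | [&& p.1 \in I, p.2 \in J & (p.2 < p.1)%N]]|.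

(* star dx_I = shuffle_sign I I^c dx_(I^c), so that dx_I /\ star dx_I is the
   volume form. *)
Definition hodge_star u : form := fun J x => shuffle_sign (~: J) J * u (~: J) x.

(* The Betti numbers are those of the de Rham cohomology of Omega. The zeroth
   one is 1 because a domain is connected. *)
Definition trivial_cohomology :=
  forall k u, (0 < k <= n)%N -> homogeneous k u ->
    (forall I, smooth_on Omega (u I)) ->
    (forall J x, Omega x -> smooth_extd u J x = 0) ->
  exists v, [/\ homogeneous k.-1 v, forall I, smooth_on Omega (v I) &
    forall J x, Omega x -> smooth_extd v J x = u J x].

Definition square_integrable f :=
  measurable_fun Omega f /\ (\int[mu]_(x in Omega) (f x ^+ 2)%:E < +oo)%E.

Definition L2 u := forall I, square_integrable (u I).
Definition L2form (k : nat) u := L2 u /\ homogeneous k u.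

(* The dx_I are orthonormal. On k-forms only the I with #|I| = k contribute. *)
Definition inner u v : R := \sum_I \int[mu]_(x in Omega) (u I x * v I x).
Definition norm2 u : R := Num.sqrt (inner u u).

Definition ae_eq_form u v :=
  forall I, {ae mu, forall x, Omega x -> u I x = v I x}.

(* d u = w in the sense of distributions, coefficient by coefficient:
   w_J = \sum_(j in J) sign_in j J * d_j u_(J \ j). *)
Definition is_weak_extd u w := forall J phi, test_function phi ->
  \int[mu]_(x in Omega) (w J x * phi x) =
  - \sum_(j in J) sign_in j J *
      \int[mu]_(x in Omega) (u (J :\ j) x * partial j phi x).

Definition is_extd (k : nat) u w := L2form k.+1 w /\ is_weak_extd u w.

(* star w = (-1)^k d (star u) weakly, for a k-form u and a (k-1)-form w; for
   k = 0 the degree condition leaves only w = 0. *)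
Definition is_codiff (k : nat) u w :=
  [/\ L2 w, forall I, #|I|.+1 != k -> w I = cst 0 &
      is_weak_extd (hodge_star u) (fun I x => (-1) ^+ k * hodge_star w I x)].

(* Almost-everywhere representatives of d u and delta u, meaningful on HL k and
   Hstar k respectively. *)
Definition extd (k : nat) u : form := xget 0 [set w | is_extd k u w].
Definition codiff (k : nat) u : form := xget 0 [set w | is_codiff k u w].

Definition HL (k : nat) u := L2form k u /\ exists w, is_extd k u w.
Definition Hstar (k : nat) u := L2form k u /\ exists w, is_codiff k u w.

Definition normHL (k : nat) u : R := Num.sqrt (norm2 u ^+ 2 + norm2 (extd k u) ^+ 2).

(* By Green's formula this is the boundary integral of tr u /\ tr (star v): as
   a functional of v in Hstar k.+1 it is the trace of u, which is only a
   distribution on the boundary for a general u in HL k. Its vanishing for all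
   v is equivalent to u being an HL k-limit of compactly supported smooth
   forms. *)
Definition boundary_term (k : nat) u v : R :=
  inner (extd k u) v - inner u (codiff k.+1 v).

Definition HL0 (k : nat) u := HL k u /\
  if (k < n)%N then forall v, Hstar k.+1 v -> boundary_term k u v = 0
  else \int[mu]_(x in Omega) u (finset.setTfor 'I_n) x = 0.

Definition Zspace (k : nat) u := HL0 k u /\ Hstar k u.

Definition is_weak_partial (j : 'I_n) f g :=
  square_integrable g /\ forall phi, test_function phi ->
    \int[mu]_(x in Omega) (g x * phi x) =
    - \int[mu]_(x in Omega) (f x * partial j phi x).
Definition weak_partial (j : 'I_n) f := xget 0 [set g | is_weak_partial j f g].

(* The norm `|x - y| of 'rV[R]_n is the sup norm. *)
Definition euclid_dist (x y : 'rV[R]_n) : R :=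
  Num.sqrt (\sum_j (x ord0 j - y ord0 j) ^+ 2).

Definition gagliardo (s : R) u : \bar R :=
  (\sum_I \int[mu]_(x in Omega) \int[mu]_(y in Omega)
    ((u I x - u I y) ^+ 2 / euclid_dist x y `^ (n%:R + 2 * s))%:E)%E.

(* For 0 < s <= 1: the Sobolev space H^1 for s = 1, otherwise the
   Sobolev-Slobodeckij space. *)
Definition HsL (s : R) (k : nat) u := L2form k u /\
  if s == 1 then forall I j, exists g, is_weak_partial j (u I) g
  else (gagliardo s u < +oo)%E.

Definition normHs (s : R) u : R := Num.sqrt (norm2 u ^+ 2 +
  if s == 1
  then \sum_I \sum_j \int[mu]_(x in Omega) (weak_partial j (u I) x ^+ 2)
  else fine (gagliardo s u)).

Definition s_regular (s : R) := forall k, (k <= n)%N -> exists C : R,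
  forall z, Zspace k z -> HsL s k z /\
    normHs s z ^+ 2 <= C * (norm2 (extd k z) ^+ 2 + norm2 (codiff k z) ^+ 2).

Definition normLp (p : \bar R) u : \bar R :=
  Lnorm mu p (fun x => (\1_Omega x * Num.sqrt (\sum_I u I x ^+ 2))%:E).

Definition finite_dimensional (V : set form) :=
  exists m (b : 'I_m -> form), forall u, V u -> exists c : 'I_m -> R,
    ae_eq_form u (fun I x => \sum_i c i * b i I x).

(* V k is the finite element space of k-forms on one mesh, as a set of
   representatives saturated under almost-everywhere equality. In degree n
   the exactness field says that V n is the range of the exterior derivative,
   as [extd n u] vanishes. *)
Record discrete_complex (V : nat -> set form) : Prop := {
  dc_conforming : forall k u, (k <= n)%N -> V k u -> HL0 k u ;
  dc_ae : forall k u v, (k <= n)%N -> V k u -> L2form k v ->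
    ae_eq_form u v -> V k v ;
  dc_zero : forall k, (k <= n)%N -> V k 0 ;
  dc_linear : forall k (a : R) u v, (k <= n)%N -> V k u -> V k v ->
    V k (fun I x => a * u I x + v I x) ;
  dc_findim : forall k, (k <= n)%N -> finite_dimensional (V k) ;
  dc_complex : forall k u, (k < n)%N -> V k u -> V k.+1 (extd k u) ;
  dc_exact : forall k u, (k <= n)%N -> V k u -> ae_eq_form (extd k u) 0 ->
    if k is j.+1 then exists v, V j v /\ ae_eq_form (extd j v) u
    else ae_eq_form u 0 }.

Definition discrete_codiff (V : nat -> set form) (k : nat) u : form :=
  if k is j.+1 then
    xget 0 [set w | V j w /\ forall v, V j v -> inner w v = inner u (extd j v)]
  else 0.

Record commuting_projection (V : nat -> set form) (Pi : nat -> form -> form)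
    : Prop := {
  cp_range : forall k u, (k <= n)%N -> HL0 k u -> V k (Pi k u) ;
  cp_id : forall k u, (k <= n)%N -> V k u -> ae_eq_form (Pi k u) u ;
  cp_linear : forall k (a : R) u v, (k <= n)%N -> HL0 k u -> HL0 k v ->
    ae_eq_form (Pi k (fun I x => a * u I x + v I x))
               (fun I x => a * Pi k u I x + Pi k v I x) ;
  cp_commute : forall k u, (k < n)%N -> HL0 k u ->
    ae_eq_form (extd k (Pi k u)) (Pi k.+1 (extd k u)) }.

(* Pi i k is the projection for the mesh i, of size h i. *)
Record uniform_bounds (Mesh : Type) (h : Mesh -> R) (s : R)
    (Pi : Mesh -> nat -> form -> form) : Prop := {
  ub_L2 : forall k, (k <= n)%N -> exists C : R, forall i u, HL0 k u ->
    norm2 (Pi i k u) <= C * norm2 u ;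
  ub_HL : forall k, (k <= n)%N -> exists C : R, forall i u, HL0 k u ->
    normHL k (Pi i k u) <= C * normHL k u ;
  ub_Lp : forall k (p : \bar R), (k <= n)%N -> (1 <= p)%E ->
    exists C : R, forall i u, HL0 k u -> (normLp p u < +oo)%E ->
      (normLp p (Pi i k u) <= C%:E * normLp p u)%E ;
  ub_approx : forall k, (k <= n)%N -> exists C : R, forall i u,
    HL0 k u -> HsL s k u ->
      norm2 (u - Pi i k u) <= C * h i `^ s * normHs s u }.

(* Hk is the generalized Hodge mapping on k-forms. *)
Definition hodge_mapping (V : nat -> set form) (k : nat) (Hk : form -> form) :=
  forall u, V k u ->
    [/\ Zspace k (Hk u), ae_eq_form (extd k (Hk u)) (extd k u) &
        forall z, Zspace k z ->
          inner (codiff k (Hk u)) (codiff k z) =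
          inner (discrete_codiff V k u) (codiff k z)].

End domain.

(* Main.v *)
Require Import Defs.
From mathcomp Require Import all_boot all_order all_algebra.
From mathcomp Require Import all_classical all_reals all_analysis.
From mathcomp Require Import measurable_realfun.
From mathcomp Require Import ring lra.
Set Implicit Arguments.
Unset Strict Implicit.
Unset Printing Implicit Defensive.
Import Order.TTheory GRing.Theory Num.Theory.
Import numFieldNormedType.Exports.
Local Open Scope classical_set_scope.
Local Open Scope ring_scope.

(** Let w be the image of u under the Hodge mapping and Pi the projection. As Pi
    commutes with d and fixes discrete forms, u - Pi w is closed; in degree 0
    exactness makes it vanish, and ||u - w|| is the projection error of w. In
    positive degree exactness gives a discrete phi with d phi = u - Pi w, which
    is taken orthogonal to the discrete closed forms. Then
<<
      ||u - w||^2 = (u - w, Pi w - w) + (u - w, d phi)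
                  = (u - w, Pi w - w) + (f, phi),
>>
    where f is the discrete codifferential of u minus the codifferential of w:
    the first is adjoint to d on discrete forms by definition, the second on
    forms of zero trace.

    By definition of the Hodge mapping, f is orthogonal to the codifferentials of
    Z, and these are all codifferentials (codiff_Zspace); equivalently f is closed
    with zero trace. Let z be the part of phi orthogonal to the closed forms of
    zero trace (coclosed_representative). It belongs to Z, with d z = d phi and
    no codifferential, and (f, phi) = (f, phi - z). Finally phi - z is controlled
    by the projection error of z (discrete_coclosed_estimate).

    Regularity bounds the projection errors of w and z by h^s times the norms of
    their derivatives and codifferentials (projection_error). For z the bound is
    h^s ||d phi|| <= h^s (||u - w|| + ||w - Pi w||), and a quadratic inequality
    for ||u - w|| results (hodge_mapping_estimate).

    The analysis serves the two decompositions. The orthogonal projections come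
    from the completeness of L2 (hilbert_projection). Weak derivatives are unique
    almost everywhere by the fundamental lemma of the calculus of variations
    (du_bois_reymond), which requires smooth bumps. That the derivative of a
    smooth compactly supported form is closed and orthogonal to all
    codifferentials rests on d d = 0, that is on Schwarz's theorem (derive_swap),
    and on integration by parts (test_by_parts). *)

(** * The L2 inner product of forms *)

(** The quadratic is tested at its minimizer -B/A; if A = 0 it is affine, and a
    nonnegative affine function is constant. *)
Lemma quadratic_discriminant {R : realFieldType} (A B C : R) : 0 <= A ->
  (forall a, 0 <= a ^+ 2 * A + 2 * a * B + C) -> B ^+ 2 <= A * C.
Proof.
rewrite le_eqVlt => /predU1P[<- P|A0 P].
  rewrite mul0r; have [->|B0] := eqVneq B 0; first by rewrite expr0n.
  have := P (- (C + 1) / (2 * B)); rewrite mulr0 add0r.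
  rewrite (_ : _ + _ = -1); last by field.
  by rewrite oppr_ge0 ler10.
have := P (- B / A); rewrite (_ : _ + _ = (A * C - B ^+ 2) / A); last first.
  by field; rewrite gt_eqF.
by rewrite pmulr_lge0 ?invr_gt0// subr_ge0.
Qed.

Section L2_algebra.
Context {R : realType} {n : nat}.
Variable (Omega : set 'rV[R]_n).
Hypothesis mOmega : measurable Omega.
Local Notation mu := (@lebesgue_row R n).
Local Notation form := (dform R n).
Implicit Types (f g : 'rV[R]_n -> R) (u v w : form).

(** This is literally the combination under which finite element spaces and
    projections are assumed linear, so those axioms apply without rewriting. *)
Definition lin (a : R) u v : form := fun I x => a * u I x + v I x.

Lemma square_integrableP f : measurable_fun Omega f ->
  square_integrable Omega f <-> mu.-integrable Omega (EFin \o (fun x => f x ^+ 2)).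
Proof.
move=> mf; split => [[_ fi]|/integrableP[_ fi]].
  apply/integrableP; split.
    by apply/measurable_EFinP; exact: measurable_funX.
  rewrite (le_lt_trans _ fi)//; apply: ge0_le_integral => //.
  - by apply: measurableT_comp => //; apply/measurable_EFinP; exact: measurable_funX.
  - by apply/measurable_EFinP; exact: measurable_funX.
  - by move=> x _ /=; rewrite lee_fin ger0_norm// sqr_ge0.
split => //; rewrite (le_lt_trans _ fi)//; apply: ge0_le_integral => //.
- by move=> x _; rewrite lee_fin sqr_ge0.
- by apply/measurable_EFinP; exact: measurable_funX.
- by apply: measurableT_comp => //; apply/measurable_EFinP; exact: measurable_funX.
- by move=> x _ /=; rewrite lee_fin ler_norm.
Qed.

Lemma square_integrable_sqr f : square_integrable Omega f ->
  mu.-integrable Omega (EFin \o (fun x => f x ^+ 2)).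
Proof. by move=> fi; apply/square_integrableP => //; case: fi. Qed.

Lemma square_integrable_mul f g : square_integrable Omega f -> square_integrable Omega g ->
  mu.-integrable Omega (EFin \o (fun x => f x * g x)).
Proof.
move=> fi gi; have [mf _] := fi; have [mg _] := gi.
apply: (le_integrable mOmega _ _ (integrableD mOmega (square_integrable_sqr fi) (square_integrable_sqr gi))).
  by apply/measurable_EFinP; exact: measurable_funM.
move=> x _ /=; rewrite lee_fin [leRHS]ger0_norm; last by rewrite addr_ge0 ?sqr_ge0.
by rewrite ler_norml; apply/andP; split; nra.
Qed.

Lemma square_integrable_lin a f g : square_integrable Omega f -> square_integrable Omega g ->
  square_integrable Omega (fun x => a * f x + g x).
Proof.
move=> fi gi; have [mf _] := fi; have [mg _] := gi.
have mfg : measurable_fun Omega (fun x => a * f x + g x).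
  by apply: measurable_funD => //; exact: measurable_funM.
apply/square_integrableP => //.
have /(integrableZl mOmega (a ^+ 2)) i1 := square_integrable_sqr fi.
have /(integrableZl mOmega (2 * a)) i2 := square_integrable_mul fi gi.
have i3 := integrableD mOmega (integrableD mOmega i1 i2) (square_integrable_sqr gi).
apply: eq_integrable i3 => // x _ /=.
by rewrite -!EFinM -!EFinD; congr EFin; ring.
Qed.

Lemma square_integrable0 : square_integrable Omega (cst 0).
Proof.
split; first exact: measurable_cst.
rewrite (_ : (fun _ => _) = cst 0%E) ?integral0 ?ltry//.
by apply/funext => x /=; rewrite expr0n.
Qed.

Lemma L2_lin a u v : L2 Omega u -> L2 Omega v -> L2 Omega (lin a u v).
Proof. by move=> hu hv I; exact: square_integrable_lin. Qed.

Lemma L2_0 : L2 Omega 0.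
Proof. by move=> I; exact: square_integrable0. Qed.

Lemma innerC u v : inner Omega u v = inner Omega v u.
Proof.
by apply: eq_bigr => I _; apply: eq_Rintegral => x _; rewrite mulrC.
Qed.

Lemma inner_linl a u v w : L2 Omega u -> L2 Omega v -> L2 Omega w ->
  inner Omega (lin a u v) w = a * inner Omega u w + inner Omega v w.
Proof.
move=> hu hv hw; rewrite /inner mulr_sumr -big_split/=; apply: eq_bigr => I _.
have i1 := square_integrable_mul (hu I) (hw I); have i2 := square_integrable_mul (hv I) (hw I).
rewrite -RintegralZl// -RintegralD//; last exact: (integrableZl mOmega a i1).
by apply: eq_Rintegral => x _; rewrite /lin mulrDl mulrA.
Qed.

Lemma inner_linr a u v w : L2 Omega u -> L2 Omega v -> L2 Omega w ->
  inner Omega w (lin a u v) = a * inner Omega w u + inner Omega w v.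
Proof. by move=> *; rewrite innerC inner_linl// ![inner _ w _]innerC. Qed.

Lemma inner0 w : inner Omega 0 w = 0.
Proof.
rewrite /inner big1// => I _.
rewrite (_ : (fun _ => _) = cst 0) ?Rintegral_cst ?mul0r//.
by apply/funext => x /=; rewrite mul0r.
Qed.

Lemma inner0r w : inner Omega w 0 = 0.
Proof. by rewrite innerC inner0. Qed.

Lemma inner_ge0 u : 0 <= inner Omega u u.
Proof.
by rewrite sumr_ge0// => I _; apply: Rintegral_ge0 => x _; rewrite -expr2 sqr_ge0.
Qed.

Lemma norm2_ge0 u : 0 <= norm2 Omega u.
Proof. exact: sqrtr_ge0. Qed.

Lemma norm2_sqr u : norm2 Omega u ^+ 2 = inner Omega u u.
Proof. by rewrite sqr_sqrtr// inner_ge0. Qed.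

Lemma subE u v : u - v = lin (-1) v u.
Proof. by apply/funext => I; apply/funext => x; rewrite /lin mulN1r addrC. Qed.

Lemma L2B u v : L2 Omega u -> L2 Omega v -> L2 Omega (u - v).
Proof. by move=> hu hv; rewrite subE; exact: L2_lin. Qed.

Lemma innerBl u v w : L2 Omega u -> L2 Omega v -> L2 Omega w ->
  inner Omega (u - v) w = inner Omega u w - inner Omega v w.
Proof. by move=> *; rewrite subE inner_linl// mulN1r addrC. Qed.

Lemma innerBr u v w : L2 Omega u -> L2 Omega v -> L2 Omega w ->
  inner Omega w (u - v) = inner Omega w u - inner Omega w v.
Proof. by move=> *; rewrite subE inner_linr// mulN1r addrC. Qed.

Lemma inner_lin_sqr a u v : L2 Omega u -> L2 Omega v ->
  inner Omega (lin a u v) (lin a u v) =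
  a ^+ 2 * inner Omega u u + 2 * a * inner Omega u v + inner Omega v v.
Proof.
move=> hu hv; rewrite inner_linl ?inner_linr//; last exact: L2_lin.
by rewrite (innerC v u); ring.
Qed.

Lemma inner_sqr_le u v : L2 Omega u -> L2 Omega v ->
  inner Omega u v ^+ 2 <= inner Omega u u * inner Omega v v.
Proof.
move=> hu hv; apply: quadratic_discriminant; first exact: inner_ge0.
by move=> a; rewrite -inner_lin_sqr// inner_ge0.
Qed.

(** The Cauchy-Schwarz inequality. *)
Lemma inner_le u v : L2 Omega u -> L2 Omega v ->
  `|inner Omega u v| <= norm2 Omega u * norm2 Omega v.
Proof.
move=> hu hv; rewrite -sqrtr_sqr /norm2 -sqrtrM ?inner_ge0//.
by rewrite ler_wsqrtr// inner_sqr_le.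
Qed.

Lemma norm2D u v : L2 Omega u -> L2 Omega v ->
  norm2 Omega (lin 1 u v) <= norm2 Omega u + norm2 Omega v.
Proof.
move=> hu hv; rewrite -(@ler_pXn2r _ 2)// ?nnegrE ?addr_ge0 ?norm2_ge0//.
rewrite norm2_sqr inner_lin_sqr// sqrrD !norm2_sqr expr1n mul1r mulr1.
by rewrite lerD2r lerD2l mulr_natl lerMn2r/= (le_trans (ler_norm _))// inner_le.
Qed.

Lemma norm2N u : L2 Omega u -> norm2 Omega (lin (-1) u 0) = norm2 Omega u.
Proof.
move=> hu; rewrite /norm2 inner_lin_sqr//; last exact: L2_0.
by rewrite (innerC u 0) !inner0 mulr0 !addr0 sqrrN expr1n mul1r.
Qed.

Lemma norm2B u v : L2 Omega u -> L2 Omega v ->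
  norm2 Omega (u - v) <= norm2 Omega u + norm2 Omega v.
Proof.
move=> hu hv.
rewrite (_ : u - v = lin 1 u (lin (-1) v 0)); last first.
  by apply/funext => I; apply/funext => x; rewrite /lin mul1r mulN1r addr0.
by rewrite -(norm2N hv); apply: norm2D => //; apply: L2_lin => //; exact: L2_0.
Qed.

Lemma ae_eq_form_sym u v : ae_eq_form Omega u v -> ae_eq_form Omega v u.
Proof.
move=> uv I; have := uv I; apply: filterS => x uvx Ox; exact/esym/uvx.
Qed.

Lemma ae_eq_form_trans u v w : ae_eq_form Omega u v -> ae_eq_form Omega v w ->
  ae_eq_form Omega u w.
Proof.
move=> uv vw I; have := vw I; have := uv I; apply: filterS2 => x uvx vwx Ox.
by rewrite uvx// vwx.
Qed.

Lemma ae_eq_lin a u v u' v' : ae_eq_form Omega u u' -> ae_eq_form Omega v v' ->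
  ae_eq_form Omega (lin a u v) (lin a u' v').
Proof.
move=> uu vv I; have := vv I; have := uu I; apply: filterS2 => x uvx vwx Ox.
by rewrite /lin uvx// vwx.
Qed.

Lemma inner_ae u v w : L2 Omega u -> L2 Omega v -> L2 Omega w ->
  ae_eq_form Omega u v -> inner Omega u w = inner Omega v w.
Proof.
move=> hu hv hw uv; apply: eq_bigr => I _; congr fine.
apply: ae_eq_integral => //.
- by have /integrableP[] := square_integrable_mul (hu I) (hw I).
- by have /integrableP[] := square_integrable_mul (hv I) (hw I).
- by have := uv I; apply: filterS => x uvx Ox; rewrite uvx.
Qed.

Lemma inner_aer u v w : L2 Omega u -> L2 Omega v -> L2 Omega w ->
  ae_eq_form Omega u v -> inner Omega w u = inner Omega w v.
Proof. by move=> *; rewrite ![inner _ w _]innerC; exact: inner_ae. Qed.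

Lemma norm2_ae u v : L2 Omega u -> L2 Omega v ->
  ae_eq_form Omega u v -> norm2 Omega u = norm2 Omega v.
Proof. by move=> hu hv uv; rewrite /norm2 (inner_ae hu hv hu uv) (inner_aer hu hv hv uv). Qed.

Lemma inner_eq0 u : L2 Omega u -> inner Omega u u = 0 -> ae_eq_form Omega u 0.
Proof.
move=> hu /eqP; rewrite psumr_eq0; last first.
  by move=> I _; apply: Rintegral_ge0 => x _; rewrite -expr2 sqr_ge0.
move=> /allP u0 I; have ii := square_integrable_mul (hu I) (hu I).
have int0 : (\int[mu]_(x in Omega) (u I x * u I x)%:E = 0)%E.
  rewrite -[LHS]fineK; last exact: integrable_fin_num.
  by congr EFin; apply/eqP; exact: u0 (mem_index_enum I).
have mm : measurable_fun Omega (EFin \o (fun x => u I x * u I x)) by case/integrableP: ii.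
have /(ae_eq_integral_abs mu mOmega mm) :
    (\int[mu]_(x in Omega) `|(EFin \o (fun x => u I x * u I x)%R) x| = 0)%E.
  rewrite -[RHS]int0; apply: eq_integral => x _ /=.
  by rewrite ger0_norm// -expr2 sqr_ge0.
apply: filterS => x ux Ox; have := ux Ox; move=> /= [] /eqP.
by rewrite mulf_eq0 orbb => /eqP.
Qed.
End L2_algebra.

(** * Completeness of L2 *)

Section L2_complete.
Context {R : realType} {n : nat}.
Variable (Omega : set 'rV[R]_n).
Hypothesis mOmega : measurable Omega.
Local Notation mu := (@lebesgue_row R n).
Hypothesis Omega_fin : (mu Omega < +oo)%E.
Local Notation form := (dform R n).

(** By |a| <= 2^m a^2 + 2^-m the increments of f are summable in L1 on a set of
    finite measure, so f converges almost everywhere, and Fatou's lemma passes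
    the L2 bounds to the limit. The last clause serves homogeneity: coefficients
    of the wrong degree have to vanish identically, not almost everywhere. *)
Lemma scalar_L2_complete (f : nat -> 'rV[R]_n -> R) (C : R) :
  (forall m, square_integrable Omega (f m)) ->
  (forall m l, (m <= l)%N ->
     (\int[mu]_(x in Omega) ((f m x - f l x) ^+ 2)%:E <= (C / 4 ^+ m)%:E)%E) ->
  exists g, [/\ square_integrable Omega g,
    (forall m, \int[mu]_(x in Omega) ((f m x - g x) ^+ 2)%:E <= (C / 4 ^+ m)%:E)%E
  & (forall m, f m = cst 0) -> g = cst 0].
Proof.
move=> fi fC.
have mf m : measurable_fun Omega (f m) by have [] := fi m.
have md m l : measurable_fun Omega (fun x => f m x - f l x).
  exact: measurable_funB.
have md2 m l : measurable_fun Omega (fun x => ((f m x - f l x) ^+ 2)%:E).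
  by apply/measurable_EFinP; exact: measurable_funX.
have mad m l : measurable_fun Omega (fun x => `|f m x - f l x|%:E).
  by apply/measurable_EFinP; exact: measurableT_comp.
have C0 : 0 <= C.
  have := fC 0 0 (leqnn 0); rewrite expr0 divr1 -lee_fin; apply: le_trans.
  by apply: integral_ge0 => x _; rewrite lee_fin sqr_ge0.
set M := fine (mu Omega).
have muM : mu Omega = M%:E by rewrite /M fineK// ge0_fin_numE.
have M0 : 0 <= M by rewrite fine_ge0.
have L1 m : (\int[mu]_(x in Omega) `|f m x - f m.+1 x|%:E <=
    ((2 * (C + M)) / (2 ^ m.+1)%:R)%:E)%E.
  apply: (@le_trans _ _ (\int[mu]_(x in Omega) ((2 ^+ m)%:E * ((f m x - f m.+1 x) ^+ 2)%:E + (2 ^- m)%:E))%E).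
    apply: ge0_le_integral => //.
      by apply: emeasurable_funD => //; exact: measurable_funeM.
    move=> x _; rewrite -EFinM -EFinD lee_fin.
    set a := `|_|; rewrite (_ : (_ - _) ^+ 2 = a ^+ 2); last by rewrite -[RHS]normrX ger0_norm ?sqr_ge0.
    have e0 : 0 < 2 ^+ m :> R by rewrite exprn_gt0.
    set e := 2 ^+ m in e0 *.
    have a0 : 0 <= a by exact: normr_ge0.
    rewrite -subr_ge0 (_ : _ - a = ((e * a - 1) ^+ 2 + e * a) / e); last by field; lra.
    by rewrite divr_ge0 ?addr_ge0 ?sqr_ge0 ?mulr_ge0// ltW.
  rewrite ge0_integralD//; last first.
  - exact: measurable_funeM.
  - by move=> x _; rewrite -EFinM lee_fin mulr_ge0// sqr_ge0.
  rewrite ge0_integralZl//; last by move=> x _; rewrite lee_fin sqr_ge0.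
  rewrite integral_cst//= muM -EFinM.
  apply: (@le_trans _ _ ((2 ^+ m)%:E * (C / 4 ^+ m)%:E + (2 ^- m * M)%:E)%E).
    by apply: leeD => //; apply: lee_wpmul2l; [rewrite lee_fin exprn_ge0|exact: fC].
  rewrite -EFinM -EFinD lee_fin le_eqVlt; apply/orP; left; apply/eqP.
  have e0 : 0 < 2 ^+ m :> R by rewrite exprn_gt0.
  rewrite natrX exprS (_ : 4 = 2 ^+ 2 :> R); last by rewrite expr2; ring.
  rewrite -exprM mulnC exprM; set e := 2 ^+ m in e0 *.
  by field; lra.
pose G x := (\sum_(m <oo) `|f m x - f m.+1 x|%:E)%E.
have mG : measurable_fun Omega G.
  apply: (@ge0_emeasurable_sum _ _ _ _ _ xpredT) => //.
have intG : (\int[mu]_(x in Omega) G x < +oo)%E.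
  rewrite integral_nneseries//.
  apply: (@le_lt_trans _ _ (2 * (C + M))%:E); last exact: ltry.
  apply: le_trans (epsilon_trick0 xpredT _); last by rewrite mulr_ge0// addr_ge0.
  apply: lee_nneseries => //.
  by move=> i _ _; apply: integral_ge0 => x _.
have G0 x : (0 <= G x)%E by apply: nneseries_ge0.
have aeG : {ae mu, forall x, Omega x -> G x \is a fin_num}.
  apply: integrable_ae => //; apply/integrableP; split => //.
  by under eq_integral do rewrite gee0_abs//.
(* The limit is taken where the increments are summable and is 0 elsewhere,
   which keeps it measurable. *)
pose A := Omega `&` [set x | G x \is a fin_num].
have mA : measurable A by exact: emeasurable_fin_num.
have AO : A `<=` Omega by move=> x [].
have cvA x : A x -> cvgn (f ^~ x).
  move=> [_ /= Gx].
  have : cvgn (series (telescope (f^~ x))).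
    apply: normed_cvg; apply: nondecreasing_is_cvgn.
      by apply: nondecreasing_series => i _ _; exact: normr_ge0.
    exists (fine (G x)) => _ [m _ <-]; rewrite -lee_fin fineK//.
    rewrite /series/= -sumEFin big_mkord.
    apply: le_trans (nneseries_lim_ge m _) => //=.
    rewrite big_mkord; apply: lee_sum => i _.
    by rewrite lee_fin /telescope distrC.
  rewrite telescopeK => /(is_cvgD (is_cvg_cst (f 0 x))).
  by congr (cvgn _); apply/funext => m /=; rewrite fctE addrC subrK.
pose g := (fun x => limn (f ^~ x)) \_ A.
have gA x : A x -> f ^~ x @ \oo --> g x.
  by move=> Ax; rewrite /g patchE mem_set//; exact: cvA.
have mgA : measurable_fun A g.
  apply: (@measurable_fun_cvg _ _ _ A f) => // m.
  exact: measurable_funS (mf m).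
have mg : measurable_fun Omega g.
  rewrite /g -(measurable_restrict _ mA mOmega) (_ : _ `&` _ = A).
    apply: (@measurable_fun_cvg _ _ _ A f) => [m|x Ax].
      exact: measurable_funS (mf m).
    exact: cvA.
  by rewrite /A setIA setIid.
have negN : mu (Omega `\` A) = 0%E.
  have [N [mN N0 sN]] := aeG.
  apply: (subset_measure0 _ mN) => //; first exact: measurableD.
  move=> x [Ox nAx]; apply: sN => /= H; apply: nAx; split => //; exact: H.
have toA (F : 'rV[R]_n -> \bar R) : measurable_fun Omega F -> (forall x, Omega x -> (0 <= F x)%E) ->
    (\int[mu]_(x in Omega) F x = \int[mu]_(x in A) F x)%E.
  move=> mF F0; rewrite (@ge0_negligible_integral _ _ _ mu Omega (Omega `\` A))//.
    by rewrite setDD setIA setIid.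
  exact: measurableD.
have bound m : (\int[mu]_(x in Omega) ((f m x - g x) ^+ 2)%:E <= (C / 4 ^+ m)%:E)%E.
  rewrite toA//; last 2 first.
  - by apply/measurable_EFinP; apply: measurable_funX; exact: measurable_funB.
  - by move=> x _; rewrite lee_fin sqr_ge0.
  pose F l x := ((f m x - f (l + m)%N x) ^+ 2)%:E.
  have FF x : A x -> limn_einf (F ^~ x) = ((f m x - g x) ^+ 2)%:E.
    move=> Ax.
    have cF : F ^~ x @ \oo --> ((f m x - g x) ^+ 2)%:E.
      apply: cvg_EFin; first by apply: nearW.
      have cl : (fun l => f (l + m)%N x) @ \oo --> g x.
        by have := gA x Ax; rewrite -(@cvg_shiftn m).
      have cd : (fun l => f m x - f (l + m)%N x) @ \oo --> f m x - g x.
        by apply: cvgB => //; exact: cvg_cst.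
      rewrite (_ : _ \o _ = (fun l => (f m x - f (l + m)%N x) * (f m x - f (l + m)%N x))).
        by rewrite expr2; exact: cvgM.
      by apply/funext => l /=; rewrite expr2.
    by have [] := cvg_limn_einf_sup cF.
  rewrite (eq_integral (fun x => limn_einf (F ^~ x))); last first.
    by move=> x /set_mem Ax; rewrite FF.
  have mFA l : measurable_fun A (F l).
    exact: measurable_funS (md2 _ _).
  apply: le_trans (fatou mu mA mFA _) _.
    by move=> l x _; rewrite lee_fin sqr_ge0.
  rewrite limn_einf_lim; apply: lime_le; first exact: is_cvg_einfs.
  apply: nearW => l; apply: (@le_trans _ _ (\int[mu]_(x in A) F l x)%E).
    by apply: ereal_inf_lbound; exists l => //=.
  rewrite -toA; last 2 first.
  - exact: md2.
  - by move=> x _; rewrite lee_fin sqr_ge0.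
  by apply: fC; rewrite leq_addl.
exists g; split => //; last first.
  move=> f0; apply/funext => x; rewrite /g patchE; case: ifP => // _.
  apply: cvg_lim => //; rewrite (_ : f^~ x = cst 0); first exact: cvg_cst.
  by apply/funext => m; rewrite f0.
have gi : square_integrable Omega (fun x => f 0 x - g x).
  split; first exact: measurable_funB.
  by apply: le_lt_trans (bound 0) _; exact: ltry.
rewrite (_ : g = (fun x => (-1) * (f 0 x - g x) + f 0 x)); last first.
  by apply/funext => x; rewrite mulN1r opprB subrK.
exact: square_integrable_lin.
Qed.
End L2_complete.

(** * Orthogonal projection *)

Section hilbert_projection.
Context {R : realType} {n : nat}.
Variable (Omega : set 'rV[R]_n).
Hypothesis mOmega : measurable Omega.
Local Notation mu := (@lebesgue_row R n).
Hypothesis Omega_fin : (mu Omega < +oo)%E.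
Local Notation form := (dform R n).
Implicit Types (u v w p q : form).

Lemma form0E I x : (0 : form) I x = 0. Proof. by []. Qed.

Lemma eq0_le_geometric (x K : R) : (forall m, `|x| <= K / 2 ^+ m) -> x = 0.
Proof.
move=> xK; apply/eqP; rewrite -normr_le0.
have cv : (fun m => K / 2 ^+ m) @ \oo --> (0 : R).
  rewrite -[0](mulr0 K); apply: cvgMr.
  under eq_fun do rewrite -exprVn.
  by apply: cvg_expr; rewrite ger0_norm ?invr_ge0// invf_lt1// ltr1n.
rewrite -(cvg_lim _ cv)//; apply: limr_ge; first exact: cvgP cv.
exact: nearW.
Qed.

Lemma L2form_lin k (a : R) u v : L2form Omega k u -> L2form Omega k v ->
  L2form Omega k (lin a u v).
Proof.
move=> [hu ku] [hv kv]; split; first exact: L2_lin.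
by move=> I Ik; rewrite /lin ku// kv//; apply/funext => x; rewrite mulr0 addr0.
Qed.

Lemma L2form0 k : L2form Omega k 0.
Proof. by split => //; exact: L2_0. Qed.

Lemma L2formB k u v : L2form Omega k u -> L2form Omega k v ->
  L2form Omega k (u - v).
Proof. by rewrite subE => *; exact: L2form_lin. Qed.

Lemma L2form_complete k (q : nat -> form) (C : R) :
  (forall m, L2form Omega k (q m)) ->
  (forall m l, (m <= l)%N ->
     inner Omega (q m - q l) (q m - q l) <= C / 4 ^+ m) ->
  exists p, L2form Omega k p /\
    forall m, inner Omega (q m - p) (q m - p) <= (#|{set 'I_n}|%:R * C) / 4 ^+ m.
Proof.
move=> kq qC.
have lq m : L2 Omega (q m) by have [] := kq m.
have fi u I : L2 Omega u ->
    (\int[mu]_(x in Omega) (u I x ^+ 2)%:E = (\int[mu]_(x in Omega) (u I x * u I x))%:E)%E.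
  move=> hu; rewrite /Rintegral fineK//.
  by apply: integrable_fin_num => //; exact: square_integrable_mul.
have cI I : exists g, [/\ square_integrable Omega g,
    (forall m, \int[mu]_(x in Omega) ((q m I x - g x) ^+ 2)%:E <= (C / 4 ^+ m)%:E)%E
  & (forall m, q m I = cst 0) -> g = cst 0].
  apply: (scalar_L2_complete mOmega Omega_fin); first by move=> m; exact: lq.
  move=> m l ml; have := fi (q m - q l) I (L2B mOmega (lq m) (lq l)) => /= ->.
  rewrite lee_fin; apply: le_trans (qC _ _ ml).
  rewrite /inner (bigD1 I)//= lerDl sumr_ge0// => J _.
  by apply: Rintegral_ge0 => x _; rewrite -expr2 sqr_ge0.
have [p pP] := choice cI.
have kp : L2form Omega k p.
  split=> [I|I Ik]; first by have [] := pP I.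
  have [_ _ ->//] := pP I.
  by move=> m; have [_ ->] := kq m.
exists p; split => // m.
have lp : L2 Omega p by case: kp.
rewrite /inner -mulrA mulr_natl -sumr_const; apply: ler_sum => I _.
have [_ + _] := pP I => /(_ m); rewrite -lee_fin; apply: le_trans.
by have := fi (q m - p) I (L2B mOmega (lq m) lp) => /= <-.
Qed.

(** The projection of u onto the orthogonal complement of S among the k-forms,
    built from a minimizing sequence. The closed subspaces needed below, the
    closed forms of zero trace and the coclosed forms, are all of this kind. *)
Lemma hilbert_projection (S : set form) k u : (forall v, S v -> L2 Omega v) ->
  L2form Omega k u ->
  exists p, [/\ L2form Omega k p, forall v, S v -> inner Omega p v = 0 &
    forall q, L2form Omega k q -> (forall v, S v -> inner Omega q v = 0) ->
      inner Omega (u - p) q = 0].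
Proof.
move=> SL ku; have lu : L2 Omega u by case: ku.
pose M : set form := [set q | L2form Omega k q /\ forall v, S v -> inner Omega q v = 0].
have ML q : M q -> L2 Omega q by case=> -[].
have Mlin a q q' : M q -> M q' -> M (lin a q q').
  move=> Mq Mq'; have [kq oq] := Mq; have [kq' oq'] := Mq'.
  split; first exact: L2form_lin.
  by move=> v Sv; rewrite inner_linl ?oq ?oq' ?mulr0 ?addr0//; auto.
have M0 : M 0 by split; [exact: L2form0|move=> v _; exact: inner0].
pose En q := inner Omega (u - q) (u - q).
have En0 q : 0 <= En q by exact: inner_ge0.
pose E := En @` M.
have lbE : has_lbound E by exists 0 => _ [q _ <-]; exact: En0.
have infE : has_inf E by split => //; exists (En 0); exists 0.
pose d := inf E.
have dle q : M q -> d <= En q by move=> Mq; apply: ge_inf => //; exists q.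
have ex m : exists q, M q /\ En q < d + 4 ^- m.
  have e0 : 0 < 4 ^- m :> R by rewrite invr_gt0 exprn_gt0.
  by have [_ [q Mq <-] lt] := inf_adherent e0 infE; exists q.
have [q qP] := choice ex.
have Mq m : M (q m) by have [] := qP m.
have lq m : L2 Omega (q m) by exact: ML.
have lx m : L2 Omega (u - q m) by exact: L2B.
(* The parallelogram law: the midpoint of q m and q l is not closer to u than
   the infimum. *)
have cau m l : (m <= l)%N -> inner Omega (q m - q l) (q m - q l) <= 4 / 4 ^+ m.
  move=> ml.
  pose mid := lin (2^-1) (q m) (lin (2^-1) (q l) 0).
  have Mmid : M mid by apply: (Mlin) => //; exact: Mlin.
  have := dle _ Mmid.
  rewrite /En (_ : u - mid = lin (2^-1) (u - q m) (lin (2^-1) (u - q l) 0)); last first.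
    by apply/funext => I; apply/funext => x; rewrite /mid /lin !fctE/= ?form0E; lra.
  have l0 : L2 Omega (0 : form) by exact: L2_0.
  have ll : L2 Omega (lin 2^-1 (u - q l) 0) by exact: L2_lin.
  rewrite inner_lin_sqr// inner_linr// inner_lin_sqr// !inner0r//.
  rewrite (_ : q m - q l = lin (-1) (u - q m) (u - q l)); last first.
    by apply/funext => I; apply/funext => x; rewrite /lin !fctE/= ?form0E; lra.
  rewrite inner_lin_sqr//.
  have [_ qm] := qP m; have [_ ql] := qP l; rewrite /En in qm ql.
  have : 4 ^- l <= 4 ^- m :> R by rewrite lef_pV2 ?posrE ?exprn_gt0// ler_weXn2l// ler1n.
  move: qm ql.
  set xx := inner _ (u - q m) (u - q m); set yy := inner _ (u - q l) (u - q l).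
  set xy := inner _ _ _; set em := 4 ^- m; set el := 4 ^- l; lra.
have [p [kp pq]] := L2form_complete (fun m => (Mq m).1) cau.
have lp : L2 Omega p by case: kp.
set K := #|{set 'I_n}|%:R * 4 in pq.
have K0 : 0 <= K by rewrite mulr_ge0.
have npq m : norm2 Omega (q m - p) <= Num.sqrt K / 2 ^+ m.
  rewrite -(@ger0_norm _ (2 ^+ m))// -sqrtr_sqr -sqrtrV ?sqr_ge0// -sqrtrM//.
  apply: ler_wsqrtr; rewrite -exprM mulnC exprM.
  by rewrite (_ : 2 ^+ 2 = 4 :> R)// expr2; lra.
have close v m : L2 Omega v ->
    `|inner Omega (q m - p) v| <= Num.sqrt K * norm2 Omega v / 2 ^+ m.
  move=> lv; apply: le_trans (inner_le mOmega (L2B mOmega (lq m) lp) lv) _.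
  by rewrite mulrAC ler_wpM2r// norm2_ge0.
exists p; split => //.
  move=> v Sv; apply: (@eq0_le_geometric _ (Num.sqrt K * norm2 Omega v)) => m.
  have := close v m (SL _ Sv); rewrite innerBl//; last exact: SL.
  by rewrite (Mq m).2// sub0r normrN.
move=> q' kq' oq'; have Mq' : M q' by [].
have lq' := ML _ Mq'.
apply: (@eq0_le_geometric _ ((1 + Num.sqrt K) * norm2 Omega q')) => m.
(* Up to 4^-m, q m minimizes the distance to u on the line through q m in the
   direction q', which makes u - q m almost orthogonal to q'. *)
have near : `|inner Omega (u - q m) q'| <= norm2 Omega q' / 2 ^+ m.
  have := @quadratic_discriminant _ (inner Omega q' q') (inner Omega q' (u - q m)) (4 ^- m)
    (inner_ge0 _ _).
  have P a : 0 <= a ^+ 2 * inner Omega q' q' + 2 * a * inner Omega q' (u - q m) + 4 ^- m.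
    have := dle _ (Mlin (- a) _ _ Mq' (Mq m)).
    rewrite /En (_ : u - _ = lin a q' (u - q m)); last first.
      by apply/funext => I; apply/funext => x; rewrite /lin !fctE/= ?form0E; lra.
    rewrite inner_lin_sqr//; have [_ qm] := qP m; rewrite /En in qm; lra.
  move=> /(_ P); rewrite innerC => D.
  rewrite -[leLHS]ger0_norm// -[leRHS]ger0_norm; last by rewrite divr_ge0// norm2_ge0.
  rewrite -[leLHS]sqrtr_sqr -[leRHS]sqrtr_sqr ler_wsqrtr//.
  rewrite real_normK ?num_real// expr_div_n norm2_sqr -exprM mulnC exprM.
  by rewrite (_ : 2 ^+ 2 = 4 :> R)// expr2; lra.
rewrite (_ : u - p = lin 1 (u - q m) (q m - p)); last first.
  by apply/funext => I; apply/funext => x; rewrite /lin !fctE/= ?form0E; lra.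
rewrite inner_linl// ?mul1r; last exact: L2B.
apply: le_trans (ler_normD _ _) _; have := close q' m lq'; move: near.
set e := 2 ^- m; set a := Num.sqrt K; nra.
Qed.
End hilbert_projection.

(** * Boxes and Borel sets of R^n *)

Section row_borel.
Context {R : realType} {n : nat}.
Local Notation mu := (@lebesgue_row R n).
Implicit Types (x y : 'rV[R]_n) (a b : 'I_n -> R).

Definition obox a b : set 'rV[R]_n := [set x | forall i, x ord0 i \in `]a i, b i[].
Definition cbox a b : set 'rV[R]_n := [set x | forall i, x ord0 i \in `[a i, b i]].

Lemma sub_obox_cbox a b : obox a b `<=` cbox a b.
Proof.
move=> x bx i; have := bx i; rewrite !in_itv/= => /andP[ax xb].
by rewrite !ltW.
Qed.

Lemma row_rect_measurable (A : 'I_n -> set (measurableTypeR R)) : (forall i, measurable (A i)) ->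
  measurable [set x : 'rV[R]_n | forall i, A i (x ord0 i)].
Proof.
move=> mA.
rewrite (_ : [set _ | _] = \bigcap_(j in [set: 'I_n]) (row_coor j @^-1` A j)).
  apply: fin_bigcap_measurable => [|j _]; first exact: finite_finset.
  by rewrite -[X in measurable X]setTI; exact: measurable_row_coor.
by apply/seteqP; split=> x Ax j; [move=> _; exact: Ax|exact: (Ax j I)].
Qed.

Lemma measurable_obox a b : measurable (obox a b).
Proof. by apply: (@row_rect_measurable (fun i => `]a i, b i[%classic)) => i; exact: measurable_itv. Qed.

Lemma measurable_cbox a b : measurable (cbox a b).
Proof. by apply: (@row_rect_measurable (fun i => `[a i, b i]%classic)) => i; exact: measurable_itv. Qed.

Lemma cbox_fin a b : (mu (cbox a b) < +oo)%E.
Proof.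
rewrite -ge0_fin_numE//.
rewrite /cbox (@lebesgue_row_box R n (fun i => `[a i, b i]%classic)); last first.
  by move=> i; exact: measurable_itv.
elim/big_ind : _ => // [x y|i _]; first exact: fin_numM.
rewrite lebesgue_measure_itv/= EFinN; by case: ifP.
Qed.

Lemma obox_ratP (U : set 'rV[R]_n) x : open U -> U x ->
  exists ab : {ffun 'I_n -> rat} * {ffun 'I_n -> rat},
    obox (ratr \o ab.1) (ratr \o ab.2) x /\ cbox (ratr \o ab.1) (ratr \o ab.2) `<=` U.
Proof.
move=> oU Ux.
have /nbhs_ballP[e /= e0 eU] : nbhs x U by exact: open_nbhs_nbhs.
have ea i : exists q : rat, ratr q \in `]x ord0 i - e, x ord0 i[.
  by apply: rat_in_itvoo; rewrite ltrBlDr ltrDl.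
have eb i : exists q : rat, ratr q \in `]x ord0 i, x ord0 i + e[.
  by apply: rat_in_itvoo; rewrite ltrDl.
have [a aP] := choice ea; have [b bP] := choice eb.
exists ([ffun i => a i], [ffun i => b i]); split.
  move=> i /=; rewrite !ffunE in_itv/=.
  by have := aP i; have := bP i; rewrite !in_itv/= => /andP[-> _] /andP[_ ->].
move=> y /= yab; apply: eU; split => // i j.
have := yab j; rewrite /= !ffunE (ord1 i) in_itv/= => /andP[ay yb].
have := aP j; have := bP j; rewrite !in_itv/= => /andP[_ b2] /andP[a1 _].
rewrite /ball/= ltr_norml; apply/andP; split; lra.
Qed.

(** The closures are kept inside U so that functions supported in them are test
    functions on U. *)
Lemma open_bigcup_obox (U : set 'rV[R]_n) : open U ->
  exists D : set ({ffun 'I_n -> rat} * {ffun 'I_n -> rat}),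
  U = \bigcup_(ab in D) obox (ratr \o ab.1) (ratr \o ab.2) /\
  forall ab, D ab -> cbox (ratr \o ab.1) (ratr \o ab.2) `<=` U.
Proof.
move=> oU; exists [set ab : {ffun 'I_n -> rat} * {ffun 'I_n -> rat} | cbox (ratr \o ab.1) (ratr \o ab.2) `<=` U]; split => //.
apply/seteqP; split => [x Ux|x [ab abU]].
  by have [ab [abx abU]] := obox_ratP oU Ux; exists ab.
by move/sub_obox_cbox; exact: abU.
Qed.

(** Boxes belong to the sigma-algebra generated by the coordinates, and countably
    many rational ones exhaust an open set. *)
Lemma open_row_measurable (U : set 'rV[R]_n) : open U -> measurable U.
Proof.
move=> /open_bigcup_obox[D [-> _]]; rewrite bigcup_mkcond.
apply: countable_bigcupT_measurable; first exact: countableP.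
by move=> ab; case: ifP => // _; exact: measurable_obox.
Qed.

Lemma continuous_row_measurable (f : 'rV[R]_n -> R) :
  continuous f -> measurable_fun setT f.
Proof.
move=> /continuousP cf; apply: (measurability _ (RGenOpens.measurableE R)).
move=> _ [_ [a [b ->] <-]]; rewrite setTI; apply: open_row_measurable.
exact/cf/interval_open.
Qed.

Lemma coor_le_norm x i : `|x ord0 i| <= `|x|.
Proof.
rewrite [leRHS]mx_normrE.
exact: (le_bigmax _ (fun ij : 'I_1 * 'I_n => `|x ij.1 ij.2|) (ord0, i)).
Qed.

Lemma bounded_sub_cbox (A : set 'rV[R]_n) : bounded_set A ->
  exists r, 0 < r /\ A `<=` cbox (fun=> - r) (fun=> r).
Proof.
move=> [M [_ AM]]; exists (Num.max M 0 + 1); split.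
  by rewrite ltr_pwDr// le_max lexx orbT.
move=> x Ax i; rewrite in_itv/= -ler_norml.
apply: le_trans (coor_le_norm x i) _; apply: AM => //.
by rewrite ltr_pwDr// le_max lexx.
Qed.

Lemma bounded_open_fin (U : set 'rV[R]_n) : open U -> bounded_set U -> (mu U < +oo)%E.
Proof.
move=> oU /bounded_sub_cbox[r [_ Ur]]; apply: le_lt_trans (cbox_fin (fun=> - r) (fun=> r)).
apply: le_measure => //; rewrite inE; first exact: open_row_measurable.
exact: measurable_cbox.
Qed.

End row_borel.

(** * Integrals of partial derivatives *)

Section line_derivative.
Context {R : realType} {V : normedModType R}.
Implicit Types (f : V -> R) (x v : V).

(** This reduces statements on directional derivatives to calculus in one
    variable. *)
Lemma is_derive_line f x v (t : R) : derivable f (t *: v + x) v ->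
  is_derive t 1 (fun t => f (t *: v + x)) ('D_v f (t *: v + x)).
Proof.
have E : (fun h : R => h^-1 *: (((fun t => f (t *: v + x)) \o shift t) (h *: 1) - f (t *: v + x)))
    = (fun h => h^-1 *: ((f \o shift (t *: v + x)) (h *: v) - f (t *: v + x))).
  by apply/funext => h /=; rewrite [h%:A]mulr1 scalerDl addrA.
by move=> df; apply: DeriveDef; rewrite /derivable/derive E.
Qed.

Lemma derive_near0 f x v : (\forall y \near x, f y = 0) -> 'D_v f x = 0.
Proof.
move=> f0; apply: cvg_lim => //; apply: cvg_near_cst.
have f00 := nbhs_singleton f0.
have cx0 : (fun h : R => h *: v + x) @ (0 : R) --> x.
  rewrite -[X in _ --> X]add0r -[X in _ --> X + _](scale0r v).
  by apply: cvgD; [apply: cvgZr_tmp; exact: cvg_id|exact: cvg_cst].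
have cx : (fun h : R => h *: v + x) @ (0 : R)^' --> x.
  by move=> A /cx0; exact: nbhs_dnbhs.
have : \forall h \near (0 : R)^', f (h *: v + x) = 0 by exact: (cx _ f0).
by apply: filterS => h /= ->; rewrite f00 subr0 scaler0.
Qed.
End line_derivative.

Section compact_support_row.
Context {R : realType}.
Local Notation mu n := (@lebesgue_row R n).

Definition supported_in n (r : R) (f : 'rV[R]_n -> R) :=
  forall x, ~ cbox (fun=> - r) (fun=> r) x -> f x = 0.

Lemma cbox_compact n (a b : 'I_n -> R) : compact (cbox a b).
Proof.
by apply: (@rV_compact _ _ (fun i => `[a i, b i]%classic)) => i; exact: segment_compact.
Qed.

Lemma supported_near n r (f : 'rV[R]_n -> R) x : supported_in r f ->
  ~ cbox (fun=> - r) (fun=> r) x -> \forall y \near x, f y = 0.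
Proof.
move=> fr xr.
have : open (~` cbox (fun=> - r) (fun=> r) : set 'rV[R]_n).
  apply: closed_openC; apply: compact_closed; last exact: cbox_compact.
  exact: norm_hausdorff.
rewrite openE => /(_ x xr) /=; apply: filterS => y; exact: fr.
Qed.

Lemma supported_partial n r (f : 'rV[R]_n -> R) j : supported_in r f ->
  supported_in r (partial j f).
Proof. by move=> fr x xr; apply: derive_near0; exact: supported_near xr. Qed.

Lemma continuous_bounded_on_compact n (f : 'rV[R]_n -> R) (K : set 'rV[R]_n) :
  continuous f -> compact K -> [bounded f x | x in K].
Proof.
move=> cf cK.
have : compact (f @` K).
  by apply: (continuous_compact _ cK); apply: continuous_subspaceT.
move=> /(@compact_bounded _ R^o) [M [Mr MK]]; exists M; split => // N /MK H x Kx.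
by apply: H; exists x.
Qed.

Lemma supported_integrable n r (f : 'rV[R]_n -> R) : continuous f ->
  supported_in r f -> (mu n).-integrable setT (EFin \o f).
Proof.
move=> cf fr.
have -> : EFin \o f = (EFin \o f) \_ (cbox (fun=> - r) (fun=> r)).
  apply/funext => x; rewrite patchE; case: ifPn => //=.
  by rewrite notin_setE => /fr ->.
apply/(integrable_mkcond _ (measurable_cbox _ _)).
apply: measurable_bounded_integrable.
- exact: measurable_cbox.
- exact: cbox_fin.
- exact: measurable_funTS (continuous_row_measurable cf).
- apply: continuous_bounded_on_compact => //; exact: cbox_compact.
Qed.

Lemma continuous_to_row (T : topologicalType) n (f : T -> 'rV[R]_n) :
  (forall i, continuous (fun t => f t ord0 i)) -> continuous f.
Proof.
move=> cf t; apply/cvg_ballP => e e0.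
have : \forall u \near t, forall i : 'I_n, ball (f t ord0 i) e (f u ord0 i).
  apply: filter_forall => i.
  by have /cvg_ballP/(_ e e0) := cf i t.
by apply: filterS => u fu; split => // i j; rewrite (ord1 i).
Qed.

Lemma continuous_cons_rowr n (x0 : R) :
  continuous (fun v : 'rV[R]_n => cons_row (x0, v)).
Proof.
apply: continuous_to_row => i.
case: (unliftP ord0 i) => [j ->|->].
  rewrite (_ : (fun _ => _) = (fun v : 'rV[R]_n => v ord0 j)).
    exact: coord_continuous.
  by apply/funext => v; rewrite mxE liftK.
rewrite (_ : (fun _ => _) = cst x0); first exact: cst_continuous.
by apply/funext => v; rewrite mxE unlift_none.
Qed.

Lemma cons_row_line n (t : R) (v : 'rV[R]_n) :
  cons_row (t, v) = t *: delta_mx ord0 ord0 + cons_row (0, v).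
Proof.
apply/rowP => i; rewrite /cons_row !mxE; case: (unliftP ord0 i) => [j ->|->].
  by rewrite /= mulr0 add0r.
by rewrite /= mulr1 addr0.
Qed.

Lemma cons_row_shift n (t h : R) (v : 'rV[R]_n) j :
  cons_row (t, h *: delta_mx ord0 j + v) =
  h *: delta_mx ord0 (lift ord0 j) + cons_row (t, v).
Proof.
apply/rowP => i; rewrite /cons_row !mxE; case: (unliftP ord0 i) => [i' ->|->].
  by rewrite /= !mxE/= (inj_eq lift_inj).
by rewrite /= mulr0 add0r.
Qed.

Lemma supported_cons_row n r (g : 'rV[R]_n.+1 -> R) (t : R) : supported_in r g ->
  supported_in r (fun v => g (cons_row (t, v))).
Proof.
move=> gr v vr; apply: gr => H; apply: vr => i.
by have := H (lift ord0 i); rewrite mxE liftK.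
Qed.

(** Fubini reduces the claim to the fundamental theorem of calculus in the
    j-th variable, the others being frozen. *)
Lemma integral_partial_eq0 n (j : 'I_n) r (g : 'rV[R]_n -> R) : 0 < r ->
  (forall x, derivable g x (delta_mx ord0 j)) -> continuous (partial j g) ->
  supported_in r g -> (\int[mu n]_x (partial j g x)%:E = 0)%E.
Proof.
move=> r0; elim: n j g => [[]//|n IH] j g dg cg gr.
have mp : measurable_fun setT (EFin \o partial j g).
  by apply/measurable_EFinP; exact: continuous_row_measurable.
pose f := (EFin \o partial j g) \o @cons_row R n.
have ig : (lebesgue_row n.+1).-integrable setT (EFin \o partial j g).
  by apply: supported_integrable => //; exact: supported_partial gr.
have mf : measurable_fun setT f.
  by apply: measurableT_comp => //; exact: measurable_cons_row.
have intf : (@lebesgue_measure R \x lebesgue_row n)%E.-integrable setT f.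
  apply/integrableP; split => //.
  have /integrableP[_] := ig.
  rewrite /= /lebesgue_row_step.
  rewrite (@ge0_integral_pushforward _ _ _ _ _ _ (@measurable_cons_row R n))//.
  apply/measurable_EFinP; apply: measurableT_comp => //.
  exact: continuous_row_measurable.
have -> : (\int[mu n.+1]_x (partial j g x)%:E =
    \int[(@lebesgue_measure R \x lebesgue_row n)%E]_z f z)%E.
  rewrite /= /lebesgue_row_step.
  rewrite (@integral_pushforward _ _ _ _ _ _ (@measurable_cons_row R n))//.
case: (unliftP ord0 j) => [j' jE|jE].
  rewrite -integral12_prod_meas1//; apply: integral0_eq => t _.
  rewrite /fubini_F.
  pose gt v := g (cons_row (t, v)).
  have Egt v : (fun h : R => h^-1 *: ((gt \o shift v) (h *: delta_mx ord0 j') - gt v)) =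
      (fun h : R => h^-1 *: ((g \o shift (cons_row (t, v))) (h *: delta_mx ord0 j) - g (cons_row (t, v)))).
    by apply/funext => h /=; rewrite /gt cons_row_shift jE.
  have E v : f (t, v) = (partial j' gt v)%:E.
    by rewrite /f /= /partial /derive Egt.
  under eq_integral do rewrite E.
  apply: IH.
  - by move=> v; have := dg (cons_row (t, v)); rewrite /derivable Egt.
  - rewrite (_ : partial j' gt = partial j g \o (fun v => cons_row (t, v))).
      by move=> v; apply: continuous_comp; [exact: continuous_cons_rowr|exact: cg].
    by apply/funext => v; have [] := E v.
  - exact: supported_cons_row.
rewrite -integral21_prod_meas1//; apply: integral0_eq => v _.
rewrite /fubini_G.
pose G (t : R) := g (t *: delta_mx ord0 j + cons_row (0, v)).
have dG (t : R) : is_derive t 1 G (partial j g (cons_row (t, v))).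
  rewrite cons_row_line -jE.
  exact: (@is_derive_line _ _ g (cons_row (0, v)) (delta_mx ord0 j) t (dg _)).
have G'E (t : R) : f (t, v) = (derive1 G t)%:E.
  by rewrite derive1E (@derive_val _ _ _ _ _ _ _ (dG t)).
have cG' : continuous (derive1 G).
  have -> : derive1 G = partial j g \o (fun t => cons_row (t, v)).
    by apply/funext => t; have [] := G'E t.
  move=> t; apply: continuous_comp; last exact: cg.
  have -> : (fun t : R => cons_row (t, v)) = (fun t => t *: delta_mx ord0 ord0 + cons_row (0, v)).
    by apply/funext => u; exact: cons_row_line.
  by apply: cvgD; [apply: cvgZr_tmp; exact: cvg_id|exact: cvg_cst].
have cG : continuous G.
  by move=> t; apply/differentiable_continuous/derivable1_diffP; have := dG t; case.
have G0 (t : R) : r < `|t| -> G t = 0.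
  move=> rt; apply: gr => H; have := H ord0; rewrite in_itv/= -ler_norml.
  rewrite /G jE -cons_row_line mxE unlift_none/=; lra.
have G'0 (t : R) : ~ `[- (r + 1), r + 1]%classic t -> derive1 G t = 0.
  move=> /= /negP; rewrite in_itv/= -ler_norml -ltNge => rt.
  have [<-] := G'E t; apply: (supported_partial j gr) => H.
  have := H ord0; rewrite in_itv/= -ler_norml mxE unlift_none/=; lra.
under eq_integral do rewrite G'E.
rewrite (_ : (fun t => (derive1 G t)%:E) = (EFin \o (derive1 G)) \_ `[- (r + 1), r + 1]); last first.
  apply/funext => t; rewrite patchE; case: ifPn => //.
  by rewrite notin_setE => /G'0 ->.
rewrite -integral_mkcond (@continuous_FTC2 _ _ G)//.
- by rewrite !G0 ?subee// ?normrN ger0_norm; lra.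
- lra.
- exact: continuous_subspaceT.
- split; [by move=> t _; have := dG t; case| |].
  + exact/cvg_at_right_filter/cG.
  + exact/cvg_at_left_filter/cG.
Qed.
End compact_support_row.

(** * Symmetry of second derivatives *)

Section schwarz.
Context {R : realType} {V : normedModType R}.
Implicit Types (f : V -> R) (a b x : V).

(** The mean value theorem, first in the direction a and then in the direction
    b. The left-hand side is symmetric in a and b. *)
Lemma mixed_difference f a b x (t : R) : 0 < t ->
  (forall y, derivable f y a) -> (forall y, derivable ('D_a f) y b) ->
  exists s r, [/\ 0 < s < t, 0 < r < t &
    f (t *: a + (t *: b + x)) - f (t *: a + x) - f (t *: b + x) + f x =
    t ^+ 2 * 'D_b ('D_a f) (r *: b + (s *: a + x))].
Proof.
move=> t0 fa fab.
pose u (s : R) := f (s *: a + (t *: b + x)) - f (s *: a + x).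
pose du (s : R) := 'D_a f (s *: a + (t *: b + x)) - 'D_a f (s *: a + x).
have uD (s : R) : is_derive s 1 u (du s) by apply: is_deriveB; exact: is_derive_line.
have cu : continuous u.
  by move=> s; apply/differentiable_continuous/derivable1_diffP; have := uD s; case.
have [s st uE] := MVT t0 (fun s _ => uD s) (continuous_subspaceT cu).
pose w (r : R) := 'D_a f (r *: b + (s *: a + x)).
have wD (r : R) : is_derive r 1 w ('D_b ('D_a f) (r *: b + (s *: a + x))).
  by apply: (@is_derive_line _ _ ('D_a f)).
have cw : continuous w.
  by move=> r; apply/differentiable_continuous/derivable1_diffP; have := wD r; case.
have [r rt wE] := MVT t0 (fun r _ => wD r) (continuous_subspaceT cw).
exists s, r; split; [by move: st; rewrite in_itv|by move: rt; rewrite in_itv|].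
move: uE wE; rewrite /u /du /w !scale0r !add0r !subr0.
rewrite (_ : s *: a + (t *: b + x) = t *: b + (s *: a + x)); last first.
  by rewrite addrCA.
move=> + wE; rewrite wE => E; set X := 'D_b _ _ in E *.
move: E; move: (f _) (f _) (f _) (f x) X => p1 p2 p3 p4 X E.
by rewrite (_ : t ^+ 2 * X = X * t * t); [rewrite -E|]; ring.
Qed.

Lemma eq_at_limit (F G : V -> R) x :
  {for x, continuous F} -> {for x, continuous G} ->
  (forall d, 0 < d -> exists y z, [/\ ball x d y, ball x d z & F y = G z]) ->
  F x = G x.
Proof.
move=> cF cG FG; apply/eqP; rewrite -subr_eq0 -normr_le0.
apply/ler_addgt0Pr => e e0; rewrite add0r.
have e20 : 0 < e / 2 by rewrite divr_gt0.
have /cvg_ballP/(_ _ e20)/nbhs_ballP[d1 /= d10 P1] : F y @[y --> x] --> F x by exact: cF.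
have /cvg_ballP/(_ _ e20)/nbhs_ballP[d2 /= d20 P2] : G y @[y --> x] --> G x by exact: cG.
have d0 : 0 < Num.min d1 d2 by rewrite lt_min d10.
have [y [z [xy xz E]]] := FG _ d0.
have le1 : Num.min d1 d2 <= d1 by rewrite ge_min lexx.
have le2 : Num.min d1 d2 <= d2 by rewrite ge_min lexx orbT.
have := P1 _ (le_ball le1 xy); have := P2 _ (le_ball le2 xz).
rewrite /= E /ball/= => qe pe.
have -> : F x - G x = (F x - G z) - (G x - G z) by rewrite opprB addrA subrK.
apply: le_trans (ler_normB _ _) _; lra.
Qed.

(** Schwarz's theorem: both mixed derivatives are limits of the same second
    differences. *)
Lemma derive_swap f a b x :
  (forall y, derivable f y a) -> (forall y, derivable ('D_a f) y b) ->
  (forall y, derivable f y b) -> (forall y, derivable ('D_b f) y a) ->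
  {for x, continuous ('D_b ('D_a f))} -> {for x, continuous ('D_a ('D_b f))} ->
  'D_b ('D_a f) x = 'D_a ('D_b f) x.
Proof.
move=> fa fab fb fba c1 c2; apply: (@eq_at_limit ('D_b ('D_a f)) ('D_a ('D_b f)) x c1 c2) => d d0.
(* Small enough for every r u + s v + x with r, s < t and u, v = a, b to lie
   within d of x. *)
pose t := d / (`|a| + `|b| + 1).
have ab0 : 0 < `|a| + `|b| + 1 by rewrite ltr_wpDl// addr_ge0.
have t0 : 0 < t by rewrite divr_gt0.
have inball s r u v : 0 < s < t -> 0 < r < t -> `|u| + `|v| = `|a| + `|b| ->
    ball x d (r *: u + (s *: v + x)).
  move=> /andP[s0 st] /andP[r0 rt] uv; rewrite -ball_normE /ball_/= distrC addrA addrK.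
  apply: (le_lt_trans (ler_normD _ _)); rewrite !normrZ !gtr0_norm//.
  apply: (@le_lt_trans _ _ (t * (`|a| + `|b|))).
    by rewrite -uv mulrDr lerD// ler_wpM2r// ltW.
  by rewrite /t mulrAC ltr_pdivrMr// ltr_pM2l// ltrDl.
have [s [r [s0t r0t E1]]] := mixed_difference x t0 fa fab.
have [s' [r' [s0t' r0t' E2]]] := mixed_difference x t0 fb fba.
exists (r *: b + (s *: a + x)), (r' *: a + (s' *: b + x)); split.
- exact: inball (addrC _ _).
- exact: inball.
apply: (@mulfI _ (t ^+ 2)); first by rewrite expf_neq0// gt_eqF.
apply: etrans (esym E1) _; apply: etrans _ E2; rewrite (addrCA (t *: a)).
by move: (f _) (f _) (f _) (f x) => p1 p2 p3 p4; ring.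
Qed.
End schwarz.

(** * Test functions *)

Section test_functions.
Context {R : realType} {n : nat}.
Variable (Omega : set 'rV[R]_n).
Hypothesis oOmega : open Omega.
Hypothesis bOmega : bounded_set Omega.
Local Notation mu := (@lebesgue_row R n).
Implicit Types (f g phi psi : 'rV[R]_n -> R).

Let mOmega : measurable Omega. Proof. exact: open_row_measurable. Qed.
Let Omega_fin : (mu Omega < +oo)%E. Proof. exact: bounded_open_fin. Qed.

Lemma smooth_partial f j : smooth_on setT f -> smooth_on setT (partial j f).
Proof. by move=> sf l x _; have := sf (rcons l j) x I; rewrite foldr_rcons. Qed.

Lemma smooth_differentiable f x : smooth_on setT f -> differentiable f x.
Proof. by move=> sf; exact: (sf [::]). Qed.

Lemma smooth_derivable f x v : smooth_on setT f -> derivable f x v.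
Proof. by move=> sf; apply: diff_derivable; exact: smooth_differentiable. Qed.

Lemma smooth_continuous f : smooth_on setT f -> continuous f.
Proof. by move=> sf x; apply: differentiable_continuous; exact: smooth_differentiable. Qed.

Lemma partial_lin a f g j : smooth_on setT f -> smooth_on setT g ->
  partial j (fun x => a * f x + g x) = fun x => a * partial j f x + partial j g x.
Proof.
move=> sf sg; apply/funext => x; rewrite /partial.
have df : derivable f x (delta_mx ord0 j) by exact: smooth_derivable.
have dg : derivable g x (delta_mx ord0 j) by exact: smooth_derivable.
have H : is_derive x (delta_mx ord0 j) (a *: f + g)
    (a *: 'D_(delta_mx ord0 j) f x + 'D_(delta_mx ord0 j) g x).
  by apply: is_deriveD; [apply: is_deriveZ|]; exact: DeriveDef.
exact: (@derive_val _ _ _ _ _ _ _ H).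
Qed.

Lemma smooth_lin a f g : smooth_on setT f -> smooth_on setT g ->
  smooth_on setT (fun x => a * f x + g x).
Proof.
move=> sf sg l x _.
suff -> : foldr partial (fun x => a * f x + g x) l =
    fun x => a * foldr partial f l x + foldr partial g l x.
  apply: (@differentiableD _ _ _ (a *: foldr partial f l)); last exact: sg.
  by apply: differentiableZ; exact: sf.
have sl h l' : smooth_on setT h -> smooth_on setT (foldr partial h l').
  by move=> sh l'' y _; rewrite -foldr_cat; exact: sh.
by elim: l => //= j l ->; rewrite partial_lin//; exact: sl.
Qed.

Lemma partial_swap f i j x : smooth_on setT f ->
  partial i (partial j f) x = partial j (partial i f) x.
Proof.
move=> sf; apply: derive_swap => [y|y|y|y||].
- exact: smooth_derivable.
- exact/smooth_derivable/(smooth_partial j sf).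
- exact: smooth_derivable.
- exact/smooth_derivable/(smooth_partial i sf).
- exact: smooth_continuous (smooth_partial i (smooth_partial j sf)) x.
- exact: smooth_continuous (smooth_partial j (smooth_partial i sf)) x.
Qed.

Lemma test_smooth phi : test_function Omega phi -> smooth_on setT phi.
Proof. by case. Qed.

Lemma test_partial phi j : test_function Omega phi -> test_function Omega (partial j phi).
Proof.
move=> [sphi [K [cK KO K0]]]; split; first exact: smooth_partial.
exists K; split => // x Kx; apply: derive_near0.
have : open (~` K : set 'rV[R]_n).
  by apply: closed_openC; apply: compact_closed => //; exact: norm_hausdorff.
by rewrite openE => /(_ x Kx) /=; apply: filterS => y; exact: K0.
Qed.

Lemma test_lin a phi psi : test_function Omega phi -> test_function Omega psi ->
  test_function Omega (fun x => a * phi x + psi x).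
Proof.
move=> [sphi [K [cK KO K0]]] [spsi [L [cL LO L0]]]; split; first exact: smooth_lin.
exists (K `|` L); split; first exact: compactU.
  by rewrite subUset.
move=> x /not_orP[Kx Lx]; rewrite K0// L0//; ring.
Qed.

Lemma test_function0 : test_function Omega (cst 0).
Proof.
split; last by exists set0; split => //; exact: compact0.
move=> l x _; suff -> : foldr partial (cst 0) l = cst (0 : R) by exact: differentiable_cst.
elim: l => //= j l ->; apply/funext => y; exact: derive_cst.
Qed.

Lemma test_sum (I : Type) (s : seq I) (P : pred I) (c : I -> R) (F : I -> 'rV[R]_n -> R) :
  (forall i, test_function Omega (F i)) ->
  test_function Omega (fun x => \sum_(i <- s | P i) c i * F i x).
Proof.
move=> tF; elim: s => [|i s IH].
  rewrite (_ : (fun _ => _) = cst 0); first exact: test_function0.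
  by apply/funext => x; rewrite big_nil.
under eq_fun do rewrite big_cons.
by case: (P i); [exact: test_lin|exact: IH].
Qed.

Lemma partial_sum (I : Type) (s : seq I) (P : pred I) (c : I -> R)
    (F : I -> 'rV[R]_n -> R) j : (forall i, test_function Omega (F i)) ->
  partial j (fun x => \sum_(i <- s | P i) c i * F i x) =
  fun x => \sum_(i <- s | P i) c i * partial j (F i) x.
Proof.
move=> tF; elim: s => [|i s IH].
  apply/funext => y; rewrite big_nil /partial.
  rewrite (_ : (fun _ => _) = cst 0); first exact: derive_cst.
  by apply/funext => x; rewrite big_nil.
under eq_fun do rewrite big_cons; under [RHS]eq_fun do rewrite big_cons.
case: (P i); last exact: IH.
by rewrite partial_lin ?IH//; apply: test_smooth => //; exact: test_sum.
Qed.

Lemma test_supported phi : test_function Omega phi ->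
  exists r, 0 < r /\ supported_in r phi.
Proof.
move=> [_ [K [_ KO K0]]]; have [r [r0 Or]] := bounded_sub_cbox bOmega.
by exists r; split => // x xr; apply: K0 => Kx; apply: xr; apply: Or; exact: KO.
Qed.

Lemma test_outside phi x : test_function Omega phi -> ~ Omega x -> phi x = 0.
Proof. by move=> [_ [K [_ KO K0]]] Ox; apply: K0 => /KO. Qed.

Lemma test_measurable phi : test_function Omega phi -> measurable_fun Omega phi.
Proof.
by move=> [sphi _]; apply: measurable_funTS; apply: continuous_row_measurable; exact: smooth_continuous.
Qed.

Lemma test_bounded phi : test_function Omega phi -> exists M, forall x, `|phi x| <= M.
Proof.
move=> tphi; have [sphi [K [cK KO K0]]] := tphi.
have [M [_ MK]] := continuous_bounded_on_compact (smooth_continuous sphi) cK.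
exists (Num.max (M + 1) 0) => x; have [Kx|Kx] := pselect (K x).
  by rewrite le_max; apply/orP; left; apply: MK => //; rewrite ltrDl.
by rewrite K0// normr0 le_max lexx orbT.
Qed.

Lemma bounded_square_integrable f M : measurable_fun Omega f -> (forall x, `|f x| <= M) ->
  square_integrable Omega f.
Proof.
move=> mf fM; apply/square_integrableP => //.
apply: measurable_bounded_integrable => //; first exact: measurable_funX.
exists (M ^+ 2); split => [|N MN]; first exact: num_real.
move=> x _ /=; rewrite normrX.
by rewrite (le_trans _ (ltW MN))// ler_pXn2r ?nnegrE// (le_trans _ (fM x)).
Qed.

Lemma test_square_integrable phi : test_function Omega phi -> square_integrable Omega phi.
Proof.
move=> tphi; have [M phiM] := test_bounded tphi.
exact: bounded_square_integrable (test_measurable tphi) phiM.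
Qed.

Lemma Rintegral_test phi : test_function Omega phi ->
  \int[mu]_(x in Omega) phi x = \int[mu]_x phi x.
Proof.
move=> tphi; rewrite Rintegral_mkcond; congr (Rintegral _ _ _); apply/funext => x.
by rewrite patchE; case: ifPn => //; rewrite notin_setE => /(test_outside tphi).
Qed.

Lemma integral_test_partial phi j : test_function Omega phi ->
  \int[mu]_(x in Omega) partial j phi x = 0.
Proof.
move=> tphi; rewrite Rintegral_test; last exact: test_partial.
have [r [r0 phir]] := test_supported tphi; have sphi := test_smooth tphi.
rewrite /Rintegral (integral_partial_eq0 r0)//.
- by move=> x; exact: smooth_derivable.
- by apply: smooth_continuous; exact: smooth_partial.
Qed.

(** The derivative of the product phi * psi has zero integral. *)
Lemma test_by_parts phi psi j : test_function Omega phi -> test_function Omega psi ->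
  \int[mu]_(x in Omega) (phi x * partial j psi x) =
  - \int[mu]_(x in Omega) (partial j phi x * psi x).
Proof.
move=> tphi tpsi; apply/eqP; rewrite -addr_eq0 -RintegralD//; last 2 first.
- apply: square_integrable_mul => //; apply: test_square_integrable => //; exact: test_partial.
- apply: square_integrable_mul => //; apply: test_square_integrable => //; exact: test_partial.
have sphi := test_smooth tphi; have spsi := test_smooth tpsi.
have E x : partial j (fun y => phi y * psi y) x = phi x * partial j psi x + partial j phi x * psi x.
  rewrite /partial (@deriveM _ _ phi psi); [|exact: smooth_derivable..].
  by rewrite [X in _ + X]mulrC.
have [r [r0 phir]] := test_supported tphi.
have out x : ~ Omega x -> phi x * partial j psi x + partial j phi x * psi x = 0.
  by move=> Ox; rewrite (test_outside tphi Ox) (test_outside tpsi Ox) mul0r mulr0 addr0.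
apply/eqP; rewrite Rintegral_mkcond (_ : _ \_ _ = partial j (fun y => phi y * psi y)); last first.
  apply/funext => x; rewrite patchE E; case: ifPn => //.
  by rewrite notin_setE => /out.
rewrite /Rintegral (integral_partial_eq0 r0)//.
- by move=> x; apply: derivableM; exact: smooth_derivable.
- rewrite (_ : partial j _ = (fun x => phi x * partial j psi x + partial j phi x * psi x)); last exact/funext.
  have c1 := smooth_continuous sphi; have c2 := smooth_continuous spsi.
  have c3 := smooth_continuous (smooth_partial j sphi).
  have c4 := smooth_continuous (smooth_partial j spsi).
  move=> x; exact: (continuousD (continuousM (c1 x) (c4 x)) (continuousM (c3 x) (c2 x))).
- by move=> x /phir ->; rewrite mul0r.
Qed.
End test_functions.

(** * Functions flat at the origin *)

Section flat_functions.
Context {R : realType}.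
Implicit Types (k : nat) (x t : R).

(** The function x^-k exp(-1/x). Its derivative is a combination of two functions
    of the same family, so that one estimate at 0 yields smoothness. *)
Definition flat k x : R := if 0 < x then x ^- k * expR (- x^-1) else 0.

Lemma flat_ge0 k x : 0 <= flat k x.
Proof.
by rewrite /flat; case: ifPn => // x0; rewrite mulr_ge0 ?expR_ge0// invr_ge0 exprn_ge0// ltW.
Qed.

(** With y = 1/x this is y^(k+1) <= (k+1)! exp y, one term of the exponential
    series. *)
Lemma flat_le_lin k x : `|flat k x| <= (k.+1)`!%:R * `|x|.
Proof.
rewrite ger0_norm ?flat_ge0// /flat; case: ifPn => [x0|_]; last by rewrite mulr_ge0.
have y0 : 0 < x^-1 by rewrite invr_gt0.
have := expR_ge1Dxn k (ltW y0).
have F0 : 0 < (k.+1)`!%:R :> R by rewrite ltr0n fact_gt0.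
move=> le1; have {le1} : x^-1 ^+ k.+1 / (k.+1)`!%:R <= expR x^-1 by lra.
rewrite ler_pdivrMr// => le1.
rewrite expRN ler_pdivrMr ?expR_gt0// gtr0_norm// -exprVn.
rewrite -(ler_pM2l y0) -exprS (le_trans le1)// mulrC mulrA -mulrA.
by rewrite le_eqVlt; apply/orP; left; apply/eqP; field; rewrite gt_eqF.
Qed.

Lemma is_derive_flat0 k : is_derive (0 : R) 1 (flat k) 0.
Proof.
have E : (fun h : R => h^-1 *: ((flat k \o shift 0) (h *: 1) - flat k 0)) @ 0^' --> (0 : R).
  (* The difference quotient of flat k at 0 is flat k.+1. *)
  have E1 h : h != 0 -> h^-1 *: ((flat k \o shift 0) (h *: 1) - flat k 0) = flat k.+1 h.
    move=> h0; rewrite /= addr0 [h%:A]mulr1 {2}/flat ltxx subr0 /flat.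
    case: ifPn => _; last by rewrite scaler0.
    by rewrite /GRing.scale/= mulrA exprS invfM.
  have n0 : (fun h : R => `|h|) @ (0 : R)^' --> (0 : R).
    have cn : (fun h : R => `|h|) @ (0 : R) --> `|0 : R| by exact: norm_continuous.
    by rewrite normr0 in cn; move=> A /cn A0; exact: (nbhs_dnbhs A0).
  have c : (fun h : R => (k.+2)`!%:R * `|h|) @ (0 : R)^' --> (0 : R).
    have : (fun h : R => (k.+2)`!%:R * `|h|) @ (0 : R)^' --> (k.+2)`!%:R * (0 : R).
      by apply: cvgMl_tmp.
    by rewrite mulr0.
  apply/norm_cvg0P.
  apply: (squeeze_cvgr _ (cvg_cst 0) c).
  near=> h; rewrite normr_ge0/= E1 ?flat_le_lin//.
  by near: h; exact: nbhs_dnbhs_neq.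
by apply: DeriveDef; [apply: cvgP E|exact: cvg_lim E].
Unshelve. all: by end_near. Qed.

Lemma is_derive_flat k x :
  is_derive x 1 (flat k) (- k%:R * flat k.+1 x + flat k.+2 x).
Proof.
have [x0|x0|<-] := ltrgtP 0 x; last 1 first.
- by rewrite /flat ltxx mulr0 addr0; exact: is_derive_flat0.
- apply: (@near_eq_is_derive _ _ _ (fun x => x^-1 ^+ k * expR (- x^-1))).
  + by near=> y; rewrite /flat ifT ?exprVn//; near: y; exact: lt_nbhsr.
  + have xn0 : x != 0 by rewrite gt_eqF.
    have di : is_derive x 1 (fun y : R => y^-1) (- x ^- 2).
      have := @is_deriveV _ id x 1 1 xn0 (is_derive_id _ _).
      by rewrite [_ *: 1]mulr1.
    have de : is_derive x 1 (fun y : R => expR (- y^-1)) (expR (- x^-1) * x ^- 2).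
      have := @is_derive1_comp _ expR (fun y : R => - y^-1) x _ _ (is_derive_expR _) (is_deriveN di).
      by rewrite opprK.
    have dk : is_derive x 1 (fun y : R => y^-1 ^+ k) (- (k%:R * x^-1 ^+ k.+1)).
      case: k => [|k]; first by rewrite mul0r oppr0; exact: is_derive_cst.
      have := is_deriveX k.+1 di; set D := _ *: _.
      rewrite (_ : D = - (k.+1%:R * x^-1 ^+ k.+2)); last first.
        by rewrite /D /GRing.scale/= !exprVn !exprS; field; rewrite expf_neq0.
      by rewrite exprfctE.
    have := is_deriveM dk de; set D := _ + _.
    rewrite (_ : D = - k%:R * flat k.+1 x + flat k.+2 x); last first.
      by rewrite /D /GRing.scale/= /flat x0 !exprVn !exprS; field; rewrite expf_neq0.
    by apply.
- rewrite /flat ltNge (ltW x0)/= mulr0 addr0.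
  apply: (@near_eq_is_derive _ _ _ (cst 0)) => //.
  by near=> y; rewrite /flat ltNge ifF// ; apply/negbF/ltW; near: y; exact: lt_nbhsl.
Unshelve. all: by end_near. Qed.
End flat_functions.

(** * Smooth bumps on boxes *)

Section bump.
Context {R : realType} {n : nat}.
Implicit Types (f g : 'rV[R]_n -> R).

(** A class closed under partial derivatives by inspection of its constructors;
    smoothness of its members follows by iteration. *)
Inductive flat_generated : ('rV[R]_n -> R) -> Prop :=
| flat_gen_cst c : flat_generated (cst c)
| flat_gen_coor k a b i : flat_generated (fun x => flat k (a * x ord0 i + b))
| flat_gen_add f g : flat_generated f -> flat_generated g ->
    flat_generated (fun x => f x + g x)
| flat_gen_mul f g : flat_generated f -> flat_generated g ->
    flat_generated (fun x => f x * g x).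

Lemma affine_coor_diff (a b : R) i (x : 'rV[R]_n) :
  differentiable (fun x : 'rV[R]_n => a * x ord0 i + b) x.
Proof.
apply: (@differentiableD _ _ _ (a *: (fun x : 'rV[R]_n => x ord0 i)) (cst b)).
  by apply: differentiableZ; exact: differentiable_coord.
exact: differentiable_cst.
Qed.

Lemma flat_generated_partial f : flat_generated f ->
  (forall x, differentiable f x) /\ forall j, flat_generated (partial j f).
Proof.
elim => [c|k a b i|{}f g _ [df pf] _ [dg pg]|{}f g sf [df pf] sg [dg pg]].
- split=> [x|j]; first exact: differentiable_cst.
  rewrite (_ : partial j _ = cst 0); first exact: flat_gen_cst.
  by apply/funext => x; exact: derive_cst.
- have dflat t : differentiable (flat k : R -> R) t.
    by apply/derivable1_diffP; have := is_derive_flat k t; case.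
  split=> [x|j].
    by apply: differentiable_comp; [exact: affine_coor_diff|exact: dflat].
  set c := a * (delta_mx ord0 j : 'rV[R]_n) ord0 i.
  rewrite (_ : partial j _ = fun x => c * (- k%:R * flat k.+1 (a * x ord0 i + b) +
      flat k.+2 (a * x ord0 i + b))).
    apply: flat_gen_mul; first exact: flat_gen_cst.
    apply: flat_gen_add; last exact: flat_gen_coor.
    by apply: flat_gen_mul; [exact: flat_gen_cst|exact: flat_gen_coor].
  apply/funext => x; set y := a * x ord0 i + b.
  transitivity ('D_c (flat k) y).
    pose F (x : 'rV[R]_n) := flat k (a * x ord0 i + b).
    have Ef : (fun h : R => h^-1 *: ((F \o shift x) (h *: delta_mx ord0 j) - F x)) =
        (fun h : R => h^-1 *: ((flat k \o shift y) (h *: c) - flat k y)).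
      apply/funext => h /=; rewrite /F !mxE; congr (_ *: (flat k _ - _)).
      by rewrite /y /c !mxE /GRing.scale/=; ring.
    by rewrite /partial /derive -/F Ef.
  have -> : c = c *: (1 : R) by rewrite /GRing.scale/= mulr1.
  rewrite deriveE// linearZ -deriveE//.
  by have := is_derive_flat k y => -[_ ->]; rewrite /GRing.scale/= mulr1.
- split=> [x|j]; first exact: (@differentiableD _ _ _ f g).
  rewrite (_ : partial j _ = fun x => partial j f x + partial j g x).
    exact: flat_gen_add.
  by apply/funext => x; rewrite /partial (@deriveD _ _ _ f g)//; exact: diff_derivable.
- split=> [x|j]; first exact: (@differentiableM _ _ f g).
  rewrite (_ : partial j _ = fun x => f x * partial j g x + g x * partial j f x).
    by apply: flat_gen_add; apply: flat_gen_mul.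
  by apply/funext => x; rewrite /partial (@deriveM _ _ f g)//; exact: diff_derivable.
Qed.

Lemma flat_generated_smooth f : flat_generated f -> smooth_on setT f.
Proof.
move=> sf l x _; suff : flat_generated (foldr partial f l).
  by move/flat_generated_partial => -[].
by elim: l => //= j l /flat_generated_partial[].
Qed.

Lemma flat_gen_prod (I : Type) (s : seq I) (F : I -> 'rV[R]_n -> R) :
  (forall i, flat_generated (F i)) ->
  flat_generated (fun x => \prod_(i <- s) F i x).
Proof.
move=> sF; elim: s => [|i s IH].
  under eq_fun do rewrite big_nil; exact: (flat_gen_cst 1).
by under eq_fun do rewrite big_cons; exact: flat_gen_mul.
Qed.

(** As m grows this tends to the indicator of the open box, because exp(-1/(m t))
    tends to 1 for t > 0. *)
Definition box_bump (a b : 'I_n -> R) (m : nat) (x : 'rV[R]_n) : R :=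
  \prod_i (flat 0 (m.+1%:R * x ord0 i + - (m.+1%:R * a i)) *
           flat 0 (- m.+1%:R * x ord0 i + m.+1%:R * b i)).

Lemma flat0_le1 (t : R) : flat 0 t <= 1.
Proof.
rewrite /flat; case: ifPn => // t0.
by rewrite expr0 invr1 mul1r -expR0 ler_expR oppr_le0 invr_ge0 ltW.
Qed.

Lemma box_bump_ge0 a b m x : 0 <= box_bump a b m x.
Proof. by apply: prodr_ge0 => i _; rewrite mulr_ge0// flat_ge0. Qed.

Lemma box_bump_le1 a b m x : box_bump a b m x <= 1.
Proof.
apply: prodr_ile1 => i _; rewrite mulr_ge0 ?flat_ge0//=.
by rewrite mulr_ile1 ?flat_ge0 ?flat0_le1.
Qed.

Lemma box_bump_out a b m x : ~ obox a b x -> box_bump a b m x = 0.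
Proof.
move=> abx; have [i] : exists i, ~ (x ord0 i \in `]a i, b i[).
  by apply/existsNP => H; exact: abx.
move=> xi; rewrite /box_bump (bigD1 i)//= [X in X * _](_ : _ = 0) ?mul0r//.
have m0 : 0 < m.+1%:R :> R by [].
have [ax|xa] := ltP (a i) (x ord0 i).
  have [xb|bx] := ltP (x ord0 i) (b i); first by exfalso; apply: xi; rewrite in_itv/= ax xb.
  rewrite [X in _ * X](_ : _ = 0) ?mulr0// /flat ifF//; apply/negbTE; rewrite -leNgt.
  by rewrite mulNr addrC -mulrBr pmulr_rle0// subr_le0.
rewrite [X in X * _](_ : _ = 0) ?mul0r// /flat ifF//; apply/negbTE; rewrite -leNgt.
by rewrite -mulrBr pmulr_rle0// subr_le0.
Qed.

Lemma flat0_cvg1 (t : R) : 0 < t -> flat 0 (m.+1%:R * t) @[m --> \oo] --> (1 : R).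
Proof.
move=> t0; have E m : flat 0 (m.+1%:R * t) = expR (- (m.+1%:R^-1 * t^-1)).
  by rewrite /flat ifT ?mulr_gt0// expr0 invr1 mul1r invfM.
under eq_fun do rewrite E.
have c0 : (fun m => m.+1%:R^-1 : R) @ \oo --> (0 : R) by exact: cvg_harmonic.
have c : (fun m => - (m.+1%:R^-1 * t^-1)) @ \oo --> (0 : R).
  by have := cvgN (cvgMr_tmp (b := t^-1) c0); rewrite mul0r oppr0; apply.
by have := @continuous_cvg _ _ _ _ _ _ expR _ (@continuous_expR R 0) c; rewrite expR0; apply.
Qed.

Lemma box_bump_cvg a b x : obox a b x -> box_bump a b m x @[m --> \oo] --> (1 : R).
Proof.
move=> abx; rewrite /box_bump.
rewrite [X in _ --> X](_ : _ = \prod_(i < n) (1 : R)); last by rewrite big1.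
apply: cvg_big => [|i _]; first exact: mul_continuous.
have := abx i; rewrite in_itv/= => /andP[ax xb].
rewrite -[X in _ --> X](mulr1 (1 : R)); apply: cvgM.
  under eq_fun do rewrite -mulrBr.
  by apply: flat0_cvg1; rewrite subr_gt0.
under eq_fun do rewrite mulNr addrC -mulrBr.
by apply: flat0_cvg1; rewrite subr_gt0.
Qed.



Lemma box_bump_test (Omega : set 'rV[R]_n) a b m : cbox a b `<=` Omega ->
  test_function Omega (box_bump a b m).
Proof.
move=> abO; split.
  apply: flat_generated_smooth; apply: flat_gen_prod => i.
  by apply: flat_gen_mul; exact: flat_gen_coor.
exists (cbox a b); split => //; first exact: cbox_compact.
by move=> x abx; apply: box_bump_out => /sub_obox_cbox.
Qed.
End bump.

(** * The fundamental lemma of the calculus of variations *)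

Section fundamental_lemma.
Context {R : realType} {n : nat}.
Local Notation mu := (@lebesgue_row R n).

Definition oboxes : set (set 'rV[R]_n) := [set A | exists a b, A = obox a b].

Lemma obox_setI (a b c d : 'I_n -> R) : obox a b `&` obox c d =
  obox (fun i => Num.max (a i) (c i)) (fun i => Num.min (b i) (d i)).
Proof.
apply/seteqP; split=> x.
  move=> [h1 h2] i; have := h1 i; have := h2 i; rewrite !in_itv/=.
  by move=> /andP[p q] /andP[r s]; rewrite gt_max lt_min p q r s.
move=> h; split=> i; have := h i; rewrite !in_itv/= gt_max lt_min;
  by move=> /andP[/andP[p q] /andP[r s]]; rewrite ?p ?q ?r ?s.
Qed.

(** Coordinate preimages of open intervals are open, hence countable unions of
    boxes. *)
Lemma row_measurable_oboxes : @measurable _ 'rV[R]_n `<=` <<s oboxes >>.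
Proof.
pose T := g_sigma_algebraType oboxes.
have mT : measurable_fun (setT : set T) (id : T -> 'rV[R]_n).
  apply: measurable_row_valued => i.
  apply: (measurability _ (RGenOpens.measurableE R)).
  move=> _ [_ [p [q ->]] <-]; rewrite setTI.
  have oU : open (row_coor i @^-1` `]p, q[ : set 'rV[R]_n).
    have c : continuous (fun x : 'rV[R]_n => x ord0 i) by exact: coord_continuous.
    by move/continuousP : c => /(_ _ (@interval_open R (BRight p) (BLeft q) isT isT)).
  have [D [-> _]] := open_bigcup_obox oU; rewrite bigcup_mkcond.
  apply: (@countable_bigcupT_measurable _ T); first exact: countableP.
  move=> ab; case: ifP => // _; apply: sub_sigma_algebra.
  by exists (ratr \o ab.1), (ratr \o ab.2).
move=> A mA; have := mT measurableT A mA; rewrite setTI preimage_id.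
exact.
Qed.

Variable (Omega : set 'rV[R]_n).
Hypothesis oOmega : open Omega.
Hypothesis bOmega : bounded_set Omega.

Let mOmega : measurable Omega. Proof. exact: open_row_measurable. Qed.
Let Omega_fin : (mu Omega < +oo)%E. Proof. exact: bounded_open_fin. Qed.

Lemma square_integrable_integrable g : square_integrable Omega g -> mu.-integrable Omega (EFin \o g).
Proof.
move=> gi; have g1 : square_integrable Omega (cst 1).
  apply: (@bounded_square_integrable _ _ _ oOmega bOmega _ 1) => //.
  by move=> x; rewrite normr1.
have := square_integrable_mul mOmega gi g1; apply: eq_integrable => // x _ /=.
by rewrite mulr1.
Qed.

Variable g : 'rV[R]_n -> R.
Hypothesis gi : square_integrable Omega g.
Hypothesis g0 : forall phi, test_function Omega phi ->
  \int[mu]_(x in Omega) (g x * phi x) = 0.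

Let gint := square_integrable_integrable gi.
Let mg : measurable_fun Omega g. Proof. by case: gi. Qed.

(** Dominated convergence along the bumps of the box. *)
Lemma integral_obox_eq0 a b : cbox a b `<=` Omega ->
  (\int[mu]_(x in obox a b) (g x)%:E = 0)%E.
Proof.
move=> abO.
have BO : obox a b `<=` Omega := subset_trans (@sub_obox_cbox _ _ a b) abO.
have mB : measurable (obox a b) by exact: measurable_obox.
rewrite -(setIidr BO) integral_mkcondr/=.
have [] := @dominated_convergence _ _ _ mu Omega mOmega
  (fun m x => (g x * box_bump a b m x)%:E) ((EFin \o g) \_ (obox a b)) (fun x => `|g x|%:E).
- move=> m; apply/measurable_EFinP; apply: measurable_funM => //.
  by apply: (@test_measurable _ _ Omega); exact: box_bump_test.
- apply/(measurable_restrict _ mB mOmega); rewrite (setIidr BO).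
  by apply/measurable_EFinP; exact: measurable_funS mg.
- apply: aeW => x Ox; rewrite patchE; case: ifPn => [/set_mem Bx|].
    apply: cvg_EFin; first exact: nearW.
    rewrite /= -[X in _ --> X]mulr1; apply: cvgMl_tmp; exact: box_bump_cvg.
  rewrite notin_setE => Bx; rewrite (_ : (fun _ => _) = cst 0%E); first exact: cvg_cst.
  by apply/funext => m; rewrite box_bump_out// mulr0.
- have := integrable_abse gint; apply: eq_integrable => //.
- apply: aeW => x m Ox; rewrite /= lee_fin normrM ler_piMr//.
  by rewrite ger0_norm ?box_bump_ge0// box_bump_le1.
move=> _ _ H; have := cvg_lim _ H; rewrite /restrict/= => <- //.
apply: cvg_lim => //; apply: cvg_near_cst; apply: nearW => m.
have tb := box_bump_test m abO.
have ib := square_integrable_mul mOmega gi (test_square_integrable oOmega bOmega tb).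
rewrite -[LHS]fineK; last exact: integrable_fin_num.
by congr EFin; exact: g0 tb.
Qed.

(** The measurable sets A with this property form a Dynkin system containing the
    boxes, which are stable under intersection. *)
Lemma integral_obox_setI_eq0 a b A : cbox a b `<=` Omega -> measurable A ->
  (\int[mu]_(x in A `&` obox a b) (g x)%:E = 0)%E.
Proof.
move=> abO.
have BO : obox a b `<=` Omega := subset_trans (@sub_obox_cbox _ _ a b) abO.
have mB : measurable (obox a b) by exact: measurable_obox.
pose H : set (set 'rV[R]_n) := [set A | measurable A /\
  (\int[mu]_(x in A `&` obox a b) (g x)%:E = 0)%E].
have gB : mu.-integrable (obox a b) (EFin \o g) by exact: integrableS gint.
have dH : dynkin H.
  split.
  - by split => //; rewrite setTI integral_obox_eq0.
  - move=> C [mC C0]; split; first exact: measurableC.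
    have := integral_obox_eq0 abO.
    have E : obox a b = (C `&` obox a b) `|` (~` C `&` obox a b).
      by rewrite -setIUl setUv setTI.
    rewrite {1}E integral_setU_EFin//.
    + by rewrite C0 add0e.
    + exact: measurableI.
    + by apply: measurableI => //; exact: measurableC.
    + by rewrite -E; exact: (measurable_funS mOmega BO mg).
    + by apply/disj_setPS => x [[? _] [? _]].
  - move=> F tF HF; have mF k : measurable (F k) by have [] := HF k.
    split; first exact: bigcupT_measurable.
    rewrite setI_bigcupl integral_bigcup.
    + by rewrite eseries0// => k _ _; have [] := HF k.
    + exact: trivIset_setIr.
    + by move=> k; exact: measurableI.
    + rewrite -setI_bigcupl; apply: integrableS gB => //.
      by apply: measurableI => //; exact: bigcupT_measurable.
move=> mA; suff : H A by case.
have : <<s oboxes >> A by exact: row_measurable_oboxes.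
rewrite -setI_closed_g_dynkin_g_sigma_algebra; last first.
  by move=> _ _ [p [q ->]] [r [t ->]]; rewrite obox_setI; do 2 eexists.
apply => //; split => // _ [p [q ->]]; split; first exact: measurable_obox.
rewrite obox_setI integral_obox_eq0//.
apply: subset_trans abO => x px i; have := px i.
by rewrite !in_itv/= ge_max le_min => /andP[/andP[_ ->] /andP[_ ->]].
Qed.

(** Omega is a countable union of boxes with closure in Omega, and on each of
    them g has zero integral over every measurable subset. *)
Lemma du_bois_reymond : {ae mu, forall x, Omega x -> g x = 0}.
Proof.
have [D [OE DO]] := open_bigcup_obox oOmega.
pose ob (ab : {ffun 'I_n -> rat} * {ffun 'I_n -> rat}) : set 'rV[R]_n :=
  obox (ratr \o ab.1) (ratr \o ab.2).
have aeD ab : D ab -> {ae mu, forall x, ob ab x -> g x = 0}.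
  move=> Dab; have abO := DO _ Dab.
  have BO : ob ab `<=` Omega := subset_trans (@sub_obox_cbox _ _ _ _) abO.
  have mB : measurable (ob ab) by exact: measurable_obox.
  have : ae_eq mu (ob ab) (EFin \o g) (cst 0%E).
    apply: integral_ae_eq => //; first exact: integrableS gint.
    move=> E EB mE; rewrite integral0 -(setIidl EB).
    exact: integral_obox_setI_eq0.
  by apply: filterS => x gx Bx; have [] := gx Bx.
have : {ae mu, forall x (k : nat), forall ab, unpickle k = Some ab -> D ab -> ob ab x -> g x = 0}.
  apply/ae_foralln => k; case: (unpickle k) => [ab|]; last exact: aeW.
  have [Dab|nD] := pselect (D ab); last first.
    by apply: aeW => x ab' [<-].
  by apply: filterS (aeD _ Dab) => x gx ab' [<-].
apply: filterS => x gx; rewrite OE => -[ab Dab abx].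
by apply: (gx (pickle ab) ab _ Dab abx); exact: pickleK.
Qed.
End fundamental_lemma.

(** * Signs of the exterior algebra *)

Section signs.
Context {R : realType} {n : nat}.
Implicit Types (I J : {set 'I_n}) (i j p : 'I_n).
Local Notation sg := (@sign_in R n).

Definition below j J : nat := #|[pred i in J | (i < j)%N]|.

Lemma below_sum j J : below j J = (\sum_(i in J) (i < j)%N)%N.
Proof.
rewrite /below -sum1_card [RHS]big_mkcond [LHS]big_mkcond/=.
by apply: eq_bigr => i _; rewrite inE; case: (i \in J); case: (_ < _)%N.
Qed.

Lemma below_setD1 i j J : i \in J -> below j J = ((i < j) + below j (J :\ i))%N.
Proof. by move=> iJ; rewrite !below_sum (big_setD1 i). Qed.

Lemma below_setU1 j I : below j (j |: I) = below j I.
Proof.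
have [jI|jI] := boolP (j \in I); first by congr below; apply/finset.setUidPr; rewrite finset.sub1set.
by rewrite (below_setD1 _ (finset.setU11 j I)) finset.setU1K// ltnn.
Qed.

(** These are the signs of the two ways of removing i and j from J; their being
    opposite gives d d = 0. *)
Lemma sign_in_swap i j J : i \in J -> j \in J -> i != j ->
  sg j J * sg i (J :\ j) = - (sg i J * sg j (J :\ i)).
Proof.
move=> iJ jJ ij; rewrite /sign_in -/(below j J) -/(below i J).
rewrite -/(below i (J :\ j)) -/(below j (J :\ i)).
rewrite (below_setD1 j iJ) (below_setD1 i jJ) !exprD.
have [ltij|ltji|eqij] := ltngtP i j.
- by rewrite expr0 expr1; ring.
- by rewrite expr0 expr1; ring.
- by move/val_inj : eqij ij => ->; rewrite eqxx.
Qed.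

Lemma shuffle_signE I J : shuffle_sign I J = (-1) ^+ (\sum_(p in I) below p J)%N :> R.
Proof.
rewrite /shuffle_sign; congr (_ ^+ _); rewrite -sum1_card.
under [RHS]eq_bigr do rewrite /below -sum1_card.
rewrite pair_big_dep/=; apply: eq_bigl => -[p q].
by rewrite !inE.
Qed.

Lemma shuffle_sign_sqr I J : shuffle_sign I J * shuffle_sign I J = 1 :> R.
Proof. by rewrite -expr2 sqrr_sign. Qed.

(** Moving j from the complement of I to I changes the shuffle sign by the parity
    of the number of elements below j in the complement plus the number of
    elements above j in I. This is what makes the codifferential, defined by the
    Hodge star, the formal adjoint of d. *)
Lemma shuffle_sign_move I j : j \notin I ->
  - (-1) ^+ #|I|.+1 * shuffle_sign I (~: I) * sg j (~: I) *
    shuffle_sign (j |: I) (~: I :\ j) = sg j (j |: I).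
Proof.
move=> jI; have jC : j \in ~: I by rewrite inE.
rewrite !shuffle_signE /sign_in -/(below j (~: I)) -/(below j (j |: I)) below_setU1.
rewrite big_setU1//=.
have -> : (\sum_(p in I) below p (~: I) = #|[pred p in I | (j < p)%N]| + \sum_(p in I) below p (~: I :\ j))%N.
  under eq_bigr do rewrite (below_setD1 _ jC).
  rewrite big_split/=; congr addn; rewrite -sum1_card [RHS]big_mkcond [LHS]big_mkcond/=.
  by apply: eq_bigr => i _; rewrite inE; case: (i \in I); case: (_ < _)%N.
have -> : #|I| = (below j I + #|[pred p in I | (j < p)%N]|)%N.
  rewrite /below -(@cardID _ [pred p : 'I_n | (p < j)%N] (mem I)); congr addn.
  apply: eq_card => p; rewrite !inE -leqNgt.
  have -> : (p \in mem I) = (p \in I) by [].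
  case pI : (p \in I); rewrite ?andbT ?andbF// andTb leq_eqVlt.
  by case: eqP => // /val_inj jp; rewrite jp pI in jI.
rewrite (below_setD1 j jC) ltnn add0n.
set a := below j I; set b := #|_|; set c := (\sum_(p in I) _)%N; set d := below j _.
rewrite !exprS !exprD.
have sq m : (-1) ^+ m * (-1) ^+ m = 1 :> R by rewrite -expr2 sqrr_sign.
transitivity ((-1) ^+ a * ((-1) ^+ b * (-1) ^+ b) * ((-1) ^+ c * (-1) ^+ c) * ((-1) ^+ d * (-1) ^+ d) :> R).
  by ring.
by rewrite !sq !mulr1.
Qed.

(** Pairs of a set and one of its elements correspond to pairs of a set and an
    element outside it; this is how sums are transposed between d and its
    adjoint. *)
Lemma sum_setD1_setU1 (V : nmodType) (F : {set 'I_n} -> 'I_n -> {set 'I_n} -> V) :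
  \sum_(J : {set 'I_n}) \sum_(j in J) F (J :\ j) j J =
  \sum_(I : {set 'I_n}) \sum_(j | j \notin I) F I j (j |: I).
Proof.
rewrite pair_big_dep/= [RHS]pair_big_dep/=.
rewrite (reindex_onto (fun p : {set 'I_n} * 'I_n => (p.2 |: p.1, p.2))
                      (fun p : {set 'I_n} * 'I_n => (p.1 :\ p.2, p.2)))/=; last first.
  by move=> [J j] /= jJ; rewrite finset.setD1K.
apply: eq_big => [[I j]|[I j] /=].
  rewrite /= finset.setU11/=; apply/eqP/idP => [[<-]|jI]; first by rewrite !inE eqxx.
  by rewrite finset.setU1K.
by move=> /andP[_ /eqP[->]].
Qed.
End signs.

(** * Weak derivatives as duality with smooth forms *)

Section form_duality.
Context {R : realType} {n : nat}.
Variable (Omega : set 'rV[R]_n).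
Hypothesis oOmega : open Omega.
Hypothesis bOmega : bounded_set Omega.
Local Notation mu := (@lebesgue_row R n).
Local Notation form := (dform R n).
Local Notation sg := (@sign_in R n).
Implicit Types (u v w Phi Psi : form) (phi : 'rV[R]_n -> R).

Let mOmega : measurable Omega. Proof. exact: open_row_measurable. Qed.

(** The formal adjoint of smooth_extd. *)
Definition smooth_codiff Phi : form := fun I x =>
  - \sum_(j | j \notin I) sg j (j |: I) * partial j (Phi (j |: I)) x.

Definition test_form Phi := forall I, test_function Omega (Phi I).

Definition monomial (J : {set 'I_n}) phi : form :=
  fun I => if I == J then phi else cst 0.

Lemma test_form_monomial J phi : test_function Omega phi -> test_form (monomial J phi).
Proof. by move=> tphi I; rewrite /monomial; case: ifP => // _; exact: test_function0. Qed.

Lemma test_form_L2 Phi : test_form Phi -> L2 Omega Phi.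
Proof. by move=> tPhi I; exact: test_square_integrable. Qed.

Lemma test_form_extd Phi : test_form Phi -> test_form (smooth_extd Phi).
Proof. by move=> tPhi J; apply: test_sum => j; exact: test_partial. Qed.

Lemma test_form_codiff Phi : test_form Phi -> test_form (smooth_codiff Phi).
Proof.
move=> tPhi I; rewrite (_ : smooth_codiff Phi I = fun x => -1 *
    (\sum_(j | j \notin I) sg j (j |: I) * partial j (Phi (j |: I)) x) + cst 0 x).
  by apply: test_lin; [apply: test_sum => j; exact: test_partial|exact: test_function0].
by apply/funext => x; rewrite /smooth_codiff mulN1r addr0.
Qed.

(** The terms of the pairs (i, j) and (j, i) cancel: the second derivatives agree
    and the signs are opposite. *)
Lemma smooth_extd_extd Phi : test_form Phi -> smooth_extd (smooth_extd Phi) = 0.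
Proof.
move=> tPhi; apply/funext => J; apply/funext => x; rewrite /smooth_extd.
pose T j i := sg j J * sg i (J :\ j) * partial j (partial i (Phi (J :\ j :\ i))) x.
transitivity (\sum_(j in J) \sum_(i | (i \in J) && (i != j)) T j i).
  apply: eq_bigr => j jJ.
  rewrite (@partial_sum _ _ Omega); last by move=> i; exact: test_partial.
  rewrite mulr_sumr; apply: eq_big => [i|i _]; first by rewrite !inE andbC.
  by rewrite mulrA.
set S := LHS; suff SN : S = - S by rewrite form0E; lra.
rewrite {1}/S (exchange_big_dep (mem J))/=; last by move=> j i _ /andP[].
rewrite /S -sumrN; apply: eq_bigr => i iJ; rewrite -sumrN.
apply: eq_big => [j|j /andP[jJ /andP[_ ij]]]; first by rewrite iJ /= eq_sym.
have Dji : J :\ j :\ i = J :\ i :\ j by rewrite !finset.setDDl finset.setUC.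
rewrite /T Dji (partial_swap j i x (test_smooth (tPhi _))) (sign_in_swap jJ iJ).
  by rewrite mulNr opprK.
by rewrite eq_sym.
Qed.

Lemma square_integrable_sum (I : Type) (s : seq I) (P : pred I) (c : I -> R) (F : I -> 'rV[R]_n -> R) :
  (forall i, square_integrable Omega (F i)) ->
  square_integrable Omega (fun x => \sum_(i <- s | P i) c i * F i x).
Proof.
move=> Fi; elim: s => [|i s IH].
  by under eq_fun do rewrite big_nil; exact: square_integrable0.
by under eq_fun do rewrite big_cons; case: (P i) => //; exact: square_integrable_lin.
Qed.

Lemma Rintegral_mul_sum (I : Type) (s : seq I) (P : pred I) (c : I -> R)
    (F : I -> 'rV[R]_n -> R) f : square_integrable Omega f ->
  (forall i, square_integrable Omega (F i)) ->
  \int[mu]_(x in Omega) (f x * (\sum_(i <- s | P i) c i * F i x)) =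
  \sum_(i <- s | P i) c i * \int[mu]_(x in Omega) (f x * F i x).
Proof.
move=> fi Fi; elim: s => [|i s IH].
  under eq_Rintegral do rewrite big_nil mulr0.
  by rewrite big_nil Rintegral_cst// mul0r.
under eq_Rintegral do rewrite big_cons.
rewrite big_cons; case: (P i) => //; rewrite -IH.
have i1 := square_integrable_mul mOmega fi (Fi i).
rewrite -RintegralZl// -RintegralD//.
- by apply: eq_Rintegral => x _; ring.
- exact: (integrableZl mOmega (c i) i1).
- exact: square_integrable_mul (square_integrable_sum _ _ _ Fi).
Qed.

Lemma inner_extd u Phi : L2 Omega u -> test_form Phi ->
  inner Omega u (smooth_extd Phi) =
  \sum_(I : {set 'I_n}) \sum_(j | j \notin I) sg j (j |: I) *
    \int[mu]_(x in Omega) (u (j |: I) x * partial j (Phi I) x).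
Proof.
move=> hu tPhi.
rewrite -(sum_setD1_setU1 (fun I j J => sg j J * \int[mu]_(x in Omega) (u J x * partial j (Phi I) x))).
apply: eq_bigr => J _; apply: Rintegral_mul_sum => // j.
by apply: test_square_integrable => //; exact: test_partial.
Qed.

Lemma inner_codiff u Phi : L2 Omega u -> test_form Phi ->
  inner Omega u (smooth_codiff Phi) =
  \sum_(J : {set 'I_n}) - \sum_(j in J) sg j J *
    \int[mu]_(x in Omega) (u (J :\ j) x * partial j (Phi J) x).
Proof.
move=> hu tPhi; rewrite sumrN.
rewrite (sum_setD1_setU1 (fun I j J => sg j J * \int[mu]_(x in Omega) (u I x * partial j (Phi J) x))).
rewrite -sumrN; apply: eq_bigr => I _.
have tp j : square_integrable Omega (partial j (Phi (j |: I))).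
  by apply: test_square_integrable => //; exact: test_partial.
rewrite -Rintegral_mul_sum//.
have ii : mu.-integrable Omega (EFin \o (fun x => u I x * \sum_(j | j \notin I) sg j (j |: I) * partial j (Phi (j |: I)) x)).
  by apply: square_integrable_mul => //; exact: square_integrable_sum.
rewrite -mulN1r -RintegralZl//; apply: eq_Rintegral => x _.
by rewrite /smooth_codiff; ring.
Qed.

Lemma inner_monomial u J phi :
  inner Omega u (monomial J phi) = \int[mu]_(x in Omega) (u J x * phi x).
Proof.
rewrite /inner (bigD1 J)//= [X in _ + X]big1 ?addr0.
  by apply: eq_Rintegral => x _; rewrite /monomial eqxx.
move=> I IJ; rewrite /monomial (negbTE IJ).
under eq_Rintegral do rewrite mulr0.
by rewrite Rintegral_cst// mul0r.
Qed.

Lemma Rintegral_mul_partial0 f j : \int[mu]_(x in Omega) (f x * partial j (cst 0) x) = 0.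
Proof.
under eq_Rintegral do rewrite /partial derive_cst mulr0.
by rewrite Rintegral_cst// mul0r.
Qed.

(** Taking linear combinations of the coefficientwise conditions turns the weak
    derivative into an adjointness relation, in which signs no longer appear. *)
Lemma is_weak_extdP u w : L2 Omega u ->
  is_weak_extd Omega u w <->
  forall Phi, test_form Phi -> inner Omega w Phi = inner Omega u (smooth_codiff Phi).
Proof.
move=> hu; split=> [uw Phi tPhi|H J phi tphi].
  by rewrite inner_codiff//; apply: eq_bigr => J _; exact: uw.
have tm := test_form_monomial J tphi.
have := H _ tm; rewrite inner_monomial inner_codiff// => ->.
rewrite (bigD1 J)//= [X in _ + X]big1 ?addr0; first by rewrite /monomial eqxx.
move=> I IJ; rewrite big1 ?oppr0// => j _.
by rewrite /monomial (negbTE IJ) Rintegral_mul_partial0 mulr0.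
Qed.

Lemma smooth_extd_weak Phi : test_form Phi -> is_weak_extd Omega Phi (smooth_extd Phi).
Proof.
move=> tPhi J phi tphi.
under eq_Rintegral do rewrite mulrC.
rewrite Rintegral_mul_sum; [|exact: test_square_integrable|]; last first.
  by move=> j; apply: test_square_integrable => //; exact: test_partial.
rewrite -sumrN; apply: eq_bigr => j _.
rewrite (test_by_parts oOmega bOmega j (tPhi _) tphi) mulrN opprK; congr (_ * _).
by apply: eq_Rintegral => x _; rewrite mulrC.
Qed.

(** Stokes' formula for compactly supported forms. *)
Lemma inner_smooth_extd Phi Psi : test_form Phi -> test_form Psi ->
  inner Omega (smooth_extd Phi) Psi = inner Omega Phi (smooth_codiff Psi).
Proof.
move=> tPhi tPsi; have := smooth_extd_weak tPhi.
by move/(is_weak_extdP _ (test_form_L2 tPhi)); exact.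
Qed.

Lemma test_form_separating w : L2 Omega w ->
  (forall Phi, test_form Phi -> inner Omega w Phi = 0) -> ae_eq_form Omega w 0.
Proof.
move=> hw w0 I; apply: (du_bois_reymond oOmega bOmega (hw I)) => phi tphi.
by rewrite -inner_monomial; exact: w0 (test_form_monomial I tphi).
Qed.

(** The condition on the coefficient of index ~: I of the Hodge star of w, once
    the signs are simplified. In the wrong degree both sides are 0. *)
Lemma hodge_star_codiff_local k u w (I : {set 'I_n}) phi : L2form Omega k u -> L2 Omega w ->
    (forall I : {set 'I_n}, #|I|.+1 != k -> w I = cst 0) -> test_function Omega phi ->
  (\int[mu]_(x in Omega) ((-1) ^+ k * hodge_star w (~: I) x * phi x) =
    - \sum_(j in ~: I) sg j (~: I) *
      \int[mu]_(x in Omega) (hodge_star u (~: I :\ j) x * partial j phi x)) <->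
  \int[mu]_(x in Omega) (w I x * phi x) =
    \sum_(j | j \notin I) sg j (j |: I) *
      \int[mu]_(x in Omega) (u (j |: I) x * partial j phi x).
Proof.
move=> [hu ku] hw kw tphi.
have CK : ~: ~: I = I by rewrite finset.setCK.
have iw := square_integrable_mul mOmega (hw I) (test_square_integrable oOmega bOmega tphi).
have L : \int[mu]_(x in Omega) ((-1) ^+ k * hodge_star w (~: I) x * phi x) =
    (-1) ^+ k * shuffle_sign I (~: I) * \int[mu]_(x in Omega) (w I x * phi x).
  by rewrite -RintegralZl//; apply: eq_Rintegral => x _; rewrite /hodge_star CK; ring.
have U j : j \notin I -> \int[mu]_(x in Omega) (hodge_star u (~: I :\ j) x * partial j phi x) =
    shuffle_sign (j |: I) (~: I :\ j) *
    \int[mu]_(x in Omega) (u (j |: I) x * partial j phi x).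
  move=> jI; rewrite -RintegralZl//; last first.
    by apply: square_integrable_mul => //; apply: test_square_integrable => //; exact: test_partial.
  have E : ~: (~: I :\ j) = j |: I by rewrite finset.setCD CK finset.setUC.
  by apply: eq_Rintegral => x _; rewrite /hodge_star E; ring.
rewrite L.
have -> : \sum_(j in ~: I) sg j (~: I) *
      \int[mu]_(x in Omega) (hodge_star u (~: I :\ j) x * partial j phi x) =
    \sum_(j | j \notin I) sg j (~: I) * shuffle_sign (j |: I) (~: I :\ j) *
      \int[mu]_(x in Omega) (u (j |: I) x * partial j phi x).
  apply: eq_big => [j|j]; first by rewrite inE.
  by rewrite inE => jI; rewrite U// mulrA.
have [kI|kI] := eqVneq #|I|.+1 k; last first.
  rewrite kw//.
  have -> : \int[mu]_(x in Omega) (cst 0 x * phi x) = 0.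
    by under eq_Rintegral do rewrite mul0r; rewrite Rintegral_cst// mul0r.
  have z j : j \notin I -> \int[mu]_(x in Omega) (u (j |: I) x * partial j phi x) = 0.
    move=> jI; rewrite ku; last by rewrite cardsU1 jI.
    by under eq_Rintegral do rewrite mul0r; rewrite Rintegral_cst// mul0r.
  rewrite !big1 ?oppr0 ?mulr0//.
  - by move=> j jI; rewrite z// mulr0.
  - by move=> j jI; rewrite z// mulr0.
set c := (-1) ^+ k * shuffle_sign I (~: I).
have cc : c * c = 1.
  rewrite /c mulrACA shuffle_sign_sqr mulr1 -expr2 sqrr_sign//.
set A := Rintegral _ _ _; set B := \sum_(j | _) _; set D := \sum_(j | _) _.
have BD : - c * B = D.
  rewrite /B /D mulr_sumr; apply: eq_bigr => j jI.
  rewrite -(@shuffle_sign_move R _ _ _ jI) kI /c; ring.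
split=> [E|->]; last by rewrite -BD; rewrite mulrA mulrN cc mulN1r.
by rewrite -BD -[A]mul1r -cc -mulrA E; ring.
Qed.

(** The codifferential defined through the Hodge star is adjoint to d on smooth
    compactly supported forms. *)
Lemma is_codiffP k u w : L2form Omega k u ->
  is_codiff Omega k u w <->
  [/\ L2 Omega w, (forall I : {set 'I_n}, #|I|.+1 != k -> w I = cst 0) &
    forall Phi, test_form Phi -> inner Omega w Phi = inner Omega u (smooth_extd Phi)].
Proof.
move=> ku; have [hu _] := ku; split=> -[hw kw uw]; split => //.
  move=> Phi tPhi; rewrite inner_extd//; apply: eq_bigr => I _.
  by apply/(hodge_star_codiff_local _ ku hw kw (tPhi I)); exact: uw.
move=> J phi tphi; rewrite -(finset.setCK J); move: (~: J) => {J} I.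
apply/(hodge_star_codiff_local _ ku hw kw tphi).
have tm := test_form_monomial I tphi.
have := uw _ tm; rewrite inner_monomial inner_extd// => ->.
rewrite (bigD1 I)//= [X in _ + X]big1 ?addr0; first by rewrite /monomial eqxx.
move=> J JI; rewrite big1// => j _.
by rewrite /monomial (negbTE JI) Rintegral_mul_partial0 mulr0.
Qed.
End form_duality.

(** * Closed and coclosed forms *)

Section hodge_decomposition.
Context {R : realType} {n : nat}.
Variable (Omega : set 'rV[R]_n).
Hypothesis oOmega : open Omega.
Hypothesis bOmega : bounded_set Omega.
Local Notation mu := (@lebesgue_row R n).
Local Notation form := (dform R n).
Implicit Types (u v w z Phi Psi : form) (I J : {set 'I_n}) (k : nat).

Let mOmega : measurable Omega. Proof. exact: open_row_measurable. Qed.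
Let Omega_fin : (mu Omega < +oo)%E. Proof. exact: bounded_open_fin. Qed.

Lemma L2_extd k u : L2form Omega k.+1 (extd Omega k u).
Proof.
rewrite /extd; have [[w kw]|nex] := pselect (exists w, is_extd Omega k u w).
  by have [] := @xgetPex _ 0 [set w | is_extd Omega k u w] (ex_intro _ w kw).
by rewrite xgetPN; [exact: L2form0|move=> w kw; apply: nex; exists w].
Qed.

Lemma L2_codiff k u : L2 Omega (codiff Omega k u) /\
  forall I, #|I|.+1 != k -> codiff Omega k u I = cst 0.
Proof.
rewrite /codiff; have [[w kw]|nex] := pselect (exists w, is_codiff Omega k u w).
  by have [] := @xgetPex _ 0 [set w | is_codiff Omega k u w] (ex_intro _ w kw).
rewrite xgetPN; last by move=> w kw; apply: nex; exists w.
by split => //; exact: L2_0.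
Qed.

Lemma L2form_codiff k u : L2form Omega k (codiff Omega k.+1 u).
Proof. by have [h1 h2] := L2_codiff k.+1 u; split => // I; exact: h2. Qed.

Lemma is_extd_weakP k u w : L2 Omega u -> is_extd Omega k u w <-> L2form Omega k.+1 w /\
  forall Phi, test_form Omega Phi -> inner Omega w Phi = inner Omega u (smooth_codiff Phi).
Proof.
by move=> hu; split => -[kw uw]; split => //; apply/(is_weak_extdP oOmega bOmega w hu).
Qed.

Lemma is_extd_lin k a u v w w' : L2 Omega u -> L2 Omega v ->
  is_extd Omega k u w -> is_extd Omega k v w' ->
  is_extd Omega k (lin a u v) (lin a w w').
Proof.
move=> hu hv /(is_extd_weakP _ _ hu)[kw uw] /(is_extd_weakP _ _ hv)[kw' vw'].
have [hw _] := kw; have [hw' _] := kw'.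
apply/is_extd_weakP; first exact: L2_lin.
split; first exact: L2form_lin.
move=> Phi tPhi; have hP := test_form_L2 oOmega bOmega tPhi.
have hc := test_form_L2 oOmega bOmega (test_form_codiff tPhi).
by rewrite !inner_linl// uw// vw'.
Qed.

Lemma is_extd_ae k u v w : L2 Omega u -> L2 Omega v -> ae_eq_form Omega u v ->
  is_extd Omega k u w -> is_extd Omega k v w.
Proof.
move=> hu hv uv /(is_extd_weakP _ _ hu)[kw uw]; apply/is_extd_weakP => //; split => // Phi tPhi.
have hc := test_form_L2 oOmega bOmega (test_form_codiff tPhi).
by rewrite uw//; exact: inner_ae.
Qed.

Lemma inner_test_inj w w' : L2 Omega w -> L2 Omega w' ->
  (forall Phi, test_form Omega Phi -> inner Omega w Phi = inner Omega w' Phi) ->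
  ae_eq_form Omega w w'.
Proof.
move=> hw hw' E.
have : ae_eq_form Omega (w - w') 0.
  apply: (test_form_separating oOmega bOmega); first exact: L2B.
  move=> Phi tPhi; have hP := test_form_L2 oOmega bOmega tPhi.
  by rewrite innerBl// E// subrr.
move=> H I; have := H I; apply: filterS => x Hx Ox.
by apply/eqP; rewrite -subr_eq0; apply/eqP; exact: Hx.
Qed.

Lemma extd_ae k u w : L2 Omega u -> is_extd Omega k u w ->
  ae_eq_form Omega (extd Omega k u) w.
Proof.
move=> hu uw; have := @xgetPex _ 0 [set w | is_extd Omega k u w] (ex_intro _ w uw).
rewrite /= -/(extd Omega k u) => /(is_extd_weakP _ _ hu)[[h1 _] E1].
move: uw => /(is_extd_weakP _ _ hu)[[h2 _] E2].
by apply: inner_test_inj => // Phi tPhi; rewrite E1// E2.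
Qed.

Lemma extdP k u : HL Omega k u -> is_extd Omega k u (extd Omega k u).
Proof. by move=> [_ ex]; exact: (@xgetPex _ 0 [set w | is_extd Omega k u w]). Qed.

Lemma codiffP k u : Hstar Omega k u -> is_codiff Omega k u (codiff Omega k u).
Proof. by move=> [_ ex]; exact: (@xgetPex _ 0 [set w | is_codiff Omega k u w]). Qed.

Lemma codiff_ae k u w : L2form Omega k u -> is_codiff Omega k u w ->
  ae_eq_form Omega (codiff Omega k u) w.
Proof.
move=> ku uw; have := codiffP (conj ku (ex_intro _ w uw)).
move=> /(is_codiffP oOmega bOmega _ ku)[h1 _ E1].
move: uw => /(is_codiffP oOmega bOmega _ ku)[h2 _ E2].
by apply: inner_test_inj => // Phi tPhi; rewrite E1// E2.
Qed.

Lemma inner_codiff_test k v Phi : Hstar Omega k v -> test_form Omega Phi ->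
  inner Omega (codiff Omega k v) Phi = inner Omega v (smooth_extd Phi).
Proof.
move=> vH tPhi; have [kv _] := vH.
by have /(is_codiffP oOmega bOmega _ kv)[_ _] := codiffP vH; exact.
Qed.

(** The component of degree k. Projections and trace conditions are stated for
    forms of one degree, while test forms have mixed degrees. *)
Definition degree_part k u : form := fun I => if #|I| == k then u I else cst 0.

Lemma degree_part_homogeneous k u : homogeneous k (degree_part k u).
Proof. by move=> I /negbTE Ik; rewrite /degree_part Ik. Qed.

Lemma degree_part_L2form k u : L2 Omega u -> L2form Omega k (degree_part k u).
Proof.
move=> hu; split; last exact: degree_part_homogeneous.
by move=> I; rewrite /degree_part; case: ifP => // _; exact: square_integrable0.
Qed.

Lemma degree_part_test k Phi : test_form Omega Phi -> test_form Omega (degree_part k Phi).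
Proof. by move=> tPhi I; rewrite /degree_part; case: ifP => // _; exact: test_function0. Qed.

Lemma inner_degree_part k u v : homogeneous k u -> inner Omega u (degree_part k v) = inner Omega u v.
Proof.
move=> ku; apply: eq_bigr => I _; rewrite /degree_part; case: ifPn => // Ik.
by rewrite ku//; apply: eq_Rintegral => x _; rewrite !mul0r.
Qed.

Lemma smooth_codiff_degree_part_homogeneous k Phi :
  homogeneous k (smooth_codiff (degree_part k.+1 Phi)).
Proof.
move=> I Ik; apply/funext => x; rewrite /smooth_codiff big1 ?oppr0// => j jI.
by rewrite /degree_part ifF ?derive_cst ?mulr0 /partial ?derive_cst ?mulr0// cardsU1 jI; exact/negbTE.
Qed.

Lemma inner_codiff_degree_part k u Phi : L2form Omega k u -> test_form Omega Phi ->
  inner Omega u (smooth_codiff (degree_part k.+1 Phi)) = inner Omega u (smooth_codiff Phi).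
Proof.
move=> [hu ku] tPhi; rewrite (inner_codiff oOmega bOmega hu tPhi).
rewrite (inner_codiff oOmega bOmega hu (degree_part_test k.+1 tPhi)).
apply: eq_bigr => J _; rewrite /degree_part; case: ifPn => Jk; first by [].
suff z j (phi : 'rV[R]_n -> R) : j \in J ->
    \int[mu]_(x in Omega) (u (J :\ j) x * phi x) = 0.
  rewrite [X in - X = _]big1 => [|j jJ]; last by rewrite z ?mulr0.
  by rewrite [X in _ = - X]big1 => [//|j jJ]; rewrite z ?mulr0.
move=> jJ; under eq_Rintegral.
  move=> x _; rewrite ku ?mul0r; first over.
  by rewrite -eqSS; have := cardsD1 j J; rewrite jJ add1n => <-.
by rewrite Rintegral_cst// mul0r.
Qed.

Lemma codiff_degree_part_Hstar k Phi : test_form Omega Phi ->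
  Hstar Omega k.+1 (degree_part k.+1 Phi) /\
  ae_eq_form Omega (codiff Omega k.+1 (degree_part k.+1 Phi)) (smooth_codiff (degree_part k.+1 Phi)).
Proof.
move=> tPhi; have tp := degree_part_test k.+1 tPhi; have tc := test_form_codiff tp.
have kp := degree_part_L2form k.+1 (test_form_L2 oOmega bOmega tPhi).
have H : is_codiff Omega k.+1 (degree_part k.+1 Phi) (smooth_codiff (degree_part k.+1 Phi)).
  apply/(is_codiffP oOmega bOmega _ kp); split; first exact: test_form_L2.
    by move=> I; exact: smooth_codiff_degree_part_homogeneous.
  by move=> Psi tPsi; rewrite innerC -inner_smooth_extd// innerC.
by split; [split => //; exists (smooth_codiff (degree_part k.+1 Phi))|exact: codiff_ae].
Qed.

(** A form orthogonal to all codifferentials is closed: the compactly supported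
    smooth forms are among the forms whose codifferentials are tested. *)
Lemma orthogonal_codiff_extd0 k u : L2form Omega k u ->
  (forall v, Hstar Omega k.+1 v -> inner Omega u (codiff Omega k.+1 v) = 0) ->
  is_extd Omega k u 0.
Proof.
move=> ku uo; have [hu _] := ku; apply/is_extd_weakP => //; split; first exact: L2form0.
move=> Phi tPhi; rewrite inner0// -(inner_codiff_degree_part ku tPhi).
have [Hp ap] := codiff_degree_part_Hstar k tPhi.
rewrite -(inner_aer mOmega _ _ hu ap) ?uo//; first by have [] := L2form_codiff k (degree_part k.+1 Phi).
exact: test_form_L2 (test_form_codiff (degree_part_test _ tPhi)).
Qed.

Lemma inner_extd_ae0 k u v : L2 Omega u -> is_extd Omega k u 0 -> L2 Omega v ->
  inner Omega (extd Omega k u) v = 0.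
Proof.
move=> hu u0 hv; have [he _] := L2_extd k u.
by rewrite (inner_ae mOmega he (L2_0 _) hv (extd_ae hu u0)) inner0.
Qed.

Lemma HL0_boundary k u v : (k < n)%N -> HL0 Omega k u -> Hstar Omega k.+1 v ->
  inner Omega (extd Omega k u) v = inner Omega u (codiff Omega k.+1 v).
Proof.
move=> kn [_]; rewrite kn => H /H; rewrite /boundary_term => /eqP.
by rewrite subr_eq0 => /eqP.
Qed.

Lemma HL0_L2form k u : HL0 Omega k u -> L2form Omega k u.
Proof. by move=> [[]]. Qed.

Lemma closed_orthogonal_codiff k u : (k < n)%N -> HL0 Omega k u ->
  ae_eq_form Omega (extd Omega k u) 0 ->
  forall v, Hstar Omega k.+1 v -> inner Omega u (codiff Omega k.+1 v) = 0.
Proof.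
move=> kn uH u0 v vH; rewrite -HL0_boundary//.
have [he _] := L2_extd k u; have [[hv _] _] := vH.
by rewrite (inner_ae mOmega he (L2_0 _) hv u0) inner0.
Qed.

(** The forms orthogonal to all codifferentials are closed, so that subtracting
    the projection of u onto them preserves d u. They include, in degree k, the
    derivatives of smooth compactly supported forms, so that the remainder z is
    coclosed. *)
Lemma coclosed_representative k u : (k < n)%N -> HL0 Omega k u ->
  exists z, [/\ Zspace Omega k z, ae_eq_form Omega (extd Omega k z) (extd Omega k u),
    ae_eq_form Omega (codiff Omega k z) 0,
    forall q, L2form Omega k q ->
      (forall v, Hstar Omega k.+1 v -> inner Omega q (codiff Omega k.+1 v) = 0) ->
      inner Omega z q = 0
  & forall v, Hstar Omega k.+1 v -> inner Omega (u - z) (codiff Omega k.+1 v) = 0].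
Proof.
move=> kn uH; have ku := HL0_L2form uH; have [hu _] := ku.
pose S : set form := [set w | exists2 v, Hstar Omega k.+1 v & w = codiff Omega k.+1 v].
have SL w : S w -> L2 Omega w by move=> [v _ ->]; have [] := L2form_codiff k v.
have [p [kp pS pP]] := hilbert_projection mOmega Omega_fin SL ku.
have [hp _] := kp.
have po v : Hstar Omega k.+1 v -> inner Omega p (codiff Omega k.+1 v) = 0.
  by move=> vH; apply: pS; exists v.
have p0 := orthogonal_codiff_extd0 kp po.
pose z := u - p; have kz : L2form Omega k z by exact: L2formB.
have [hz _] := kz.
have zq q : L2form Omega k q ->
    (forall v, Hstar Omega k.+1 v -> inner Omega q (codiff Omega k.+1 v) = 0) ->
    inner Omega z q = 0.
  by move=> kq qo; apply: pP => // w [v vH ->]; exact: qo.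
have dz : is_extd Omega k z (extd Omega k u).
  have -> : z = lin (-1) p u by exact: subE.
  have -> : extd Omega k u = lin (-1) 0 (extd Omega k u).
    by apply/funext => I; apply/funext => x; rewrite /lin form0E mulr0 add0r.
  by apply: is_extd_lin => //; apply: extdP; case: uH.
have ez := extd_ae hz dz.
have [he _] := L2_extd k u; have [hez _] := L2_extd k z.
have zcod : is_codiff Omega k z 0.
  apply/(is_codiffP oOmega bOmega _ kz); split; [exact: L2_0|by []|].
  move=> Phi tPhi; have te := test_form_extd tPhi; have he' := test_form_L2 oOmega bOmega te.
  rewrite inner0//; apply/esym; rewrite -(inner_degree_part _ kz.2).
  apply: zq; first exact: degree_part_L2form.
  move=> v vH; rewrite innerC inner_degree_part; last by have [] := L2form_codiff k v.
  by rewrite inner_codiff_test// (smooth_extd_extd tPhi) inner0r.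
exists z; split.
- split; last by split => //; exists 0.
  split; first by split => //; exists (extd Omega k u).
  rewrite kn => v vH; have [[hv _] _] := vH; have [hc _] := L2form_codiff k v.
  by rewrite /boundary_term (inner_ae mOmega hez he hv ez) HL0_boundary// innerBl// po// subr0 subrr.
- exact: ez.
- exact: codiff_ae.
- exact: zq.
- move=> v vH; rewrite (_ : u - z = p) ?po//.
  by rewrite /z opprB addrC subrK.
Qed.

(** Subtracting from v its projection onto the coclosed forms does not change the
    codifferential. The rest is orthogonal to the codifferentials of smooth
    compactly supported forms, hence closed, and to those of all forms, hence of
    zero trace; in degree n it is orthogonal to the constant volume form, hence
    of mean zero. *)
Lemma codiff_Zspace k v : (k <= n)%N -> Hstar Omega k v ->
  exists z, Zspace Omega k z /\ ae_eq_form Omega (codiff Omega k z) (codiff Omega k v).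
Proof.
move=> kn vH; have [kv _] := vH; have [hv _] := kv.
pose S : set form := [set w | exists2 Phi, test_form Omega Phi & w = smooth_extd Phi].
have SL w : S w -> L2 Omega w.
  by move=> [Phi tPhi ->]; apply: test_form_L2 => //; exact: test_form_extd.
have [p [kp pS pP]] := hilbert_projection mOmega Omega_fin SL kv.
have [hp _] := kp; pose z := v - p; have kz : L2form Omega k z by exact: L2formB.
have [hz _] := kz.
have zcod : is_codiff Omega k z (codiff Omega k v).
  have [hc kc] := L2_codiff k v.
  apply/(is_codiffP oOmega bOmega _ kz); split => // Phi tPhi.
  have te := test_form_L2 oOmega bOmega (test_form_extd tPhi).
  rewrite innerBl// pS ?subr0; first exact: inner_codiff_test.
  by exists Phi.
have zq q : L2form Omega k q ->
    (forall Phi, test_form Omega Phi -> inner Omega q (smooth_extd Phi) = 0) ->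
    inner Omega z q = 0.
  by move=> kq qo; apply: pP => // w [Phi tPhi ->]; exact: qo.
have dz : is_extd Omega k z 0.
  apply/is_extd_weakP => //; split; first exact: L2form0.
  move=> Psi tPsi; rewrite inner0// -(inner_codiff_degree_part kz tPsi).
  have tp := degree_part_test k.+1 tPsi; have tc := test_form_codiff tp.
  apply/esym/zq; first by split; [exact: test_form_L2|exact: smooth_codiff_degree_part_homogeneous].
  move=> Phi tPhi; have te := test_form_extd tPhi.
  by rewrite innerC -inner_smooth_extd// (smooth_extd_extd tPhi) inner0.
exists z; split; last exact: codiff_ae.
split; last by split => //; exists (codiff Omega k v).
split; first by split => //; exists 0.
case: ifPn => [ltkn|].
  move=> v' v'H; have [[hv' _] _] := v'H; rewrite /boundary_term inner_extd_ae0// sub0r.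
  rewrite zq ?oppr0//; first exact: L2form_codiff.
  by move=> Phi tPhi; rewrite inner_codiff_test// ?(smooth_extd_extd tPhi) ?inner0r//; exact: test_form_extd.
rewrite -leqNgt => nk; have kE : k = n by apply/eqP; rewrite eqn_leq kn.
pose T : {set 'I_n} := finset.setTfor 'I_n.
have c1 : square_integrable Omega (cst 1).
  apply: (@bounded_square_integrable _ _ _ oOmega bOmega _ 1) => // x.
  by rewrite normr1.
have := zq (monomial T (cst 1)).
rewrite inner_monomial//; under eq_Rintegral do rewrite mulr1.
apply.
  split => [I|I Ik]; rewrite /monomial; first by case: ifP => // _; exact: square_integrable0.
  by rewrite ifF//; apply/negbTE; apply: contraNneq Ik => ->; rewrite cardsT card_ord kE.
move=> Phi tPhi; rewrite innerC inner_monomial//.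
under eq_Rintegral do rewrite mulrC.
rewrite (Rintegral_mul_sum oOmega) => [|//|j]; last first.
  by apply: test_square_integrable => //; exact: test_partial.
rewrite big1// => j _; under eq_Rintegral do rewrite mul1r.
by rewrite (integral_test_partial bOmega j (tPhi _)) mulr0.
Qed.
End hodge_decomposition.

(** * Orthonormal bases of finite-dimensional spaces *)

Section finite_dimensional_riesz.
Context {R : realType} {n : nat}.
Variable (Omega : set 'rV[R]_n).
Hypothesis mOmega : measurable Omega.
Local Notation form := (dform R n).
Implicit Types (u v w : form).

Definition lincomb m (c : 'I_m -> R) (b : 'I_m -> form) : form :=
  fun I x => \sum_i c i * b i I x.

Variable V : set form.
Hypothesis V_L2 : forall v, V v -> L2 Omega v.
Hypothesis V_0 : V 0.
Hypothesis V_lin : forall a u v, V u -> V v -> V (lin a u v).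
Hypothesis V_findim : finite_dimensional Omega V.

Lemma lincombS m (c : 'I_m.+1 -> R) (b : 'I_m.+1 -> form) :
  lincomb c b = lin (c ord0) (b ord0) (lincomb (c \o lift ord0) (b \o lift ord0)).
Proof. by apply/funext => I; apply/funext => x; rewrite /lincomb big_ord_recl. Qed.

Lemma lincomb_in m (c : 'I_m -> R) (b : 'I_m -> form) :
  (forall i, V (b i)) -> V (lincomb c b).
Proof.
elim: m c b => [|m IH] c b Vb; last by rewrite lincombS; apply: V_lin => //; apply: IH => i; exact: Vb.
rewrite (_ : lincomb c b = 0)//.
by apply/funext => I; apply/funext => x; rewrite /lincomb big_ord0.
Qed.

Lemma functional_lincomb (l : form -> R) :
  (forall a u v, V u -> V v -> l (lin a u v) = a * l u + l v) -> l 0 = 0 ->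
  forall m (c : 'I_m -> R) (b : 'I_m -> form), (forall i, V (b i)) ->
  l (lincomb c b) = \sum_i c i * l (b i).
Proof.
move=> llin l0; elim=> [|m IH] c b Vb.
  rewrite big_ord0 (_ : lincomb c b = 0)//.
  by apply/funext => I; apply/funext => x; rewrite /lincomb big_ord0.
have Vb' i : V ((b \o lift ord0) i) by exact: Vb.
by rewrite lincombS llin//; [rewrite big_ord_recl IH|exact: lincomb_in].
Qed.

Lemma inner_lincomb m (c : 'I_m -> R) (b : 'I_m -> form) w :
  (forall i, V (b i)) -> V w -> inner Omega (lincomb c b) w = \sum_i c i * inner Omega (b i) w.
Proof.
move=> Vb Vw.
apply: (functional_lincomb (l := fun u => inner Omega u w)) => //; last exact: inner0.
by move=> a u v Vu Vv; rewrite inner_linl//; exact: V_L2.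
Qed.

Definition orthonormal_family m (e : 'I_m -> form) :=
  (forall i, V (e i)) /\ forall i j, inner Omega (e i) (e j) = (i == j)%:R.

(** The spanning forms b need not belong to V, so independence is tested on the
    coordinates: more than d rows of length d are linearly dependent. *)
Lemma orthonormal_bound : exists d, forall m (e : 'I_m -> form),
  orthonormal_family e -> (m <= d)%N.
Proof.
have [d [b bP]] := V_findim; exists d => m e [Ve oe].
have [C CP] := choice (fun i => bP _ (Ve i)).
pose M : 'M[R]_(m, d) := \matrix_(i, k) C i k.
rewrite leqNgt; apply/negP => dm.
have : kermx M != 0.
  rewrite -mxrank_eq0 mxrank_ker subn_eq0 -ltnNge.
  by rewrite (leq_ltn_trans _ dm)// rank_leq_col.
move/rowV0Pn => [y /sub_kermxP yM]; apply/negP; rewrite negbK; apply/eqP/rowP => i.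
have lc0 : ae_eq_form Omega (lincomb (y ord0) e) 0.
  move=> I.
  have : {ae (@lebesgue_row R n), forall x, forall i, Omega x -> e i I x = \sum_k C i k * b k I x}.
    by apply: filter_forall => i'; exact: CP.
  apply: filterS => x ex Ox; rewrite /lincomb.
  under eq_bigr do rewrite ex//.
  under eq_bigr do rewrite mulr_sumr.
  rewrite exchange_big/= big1// => k _.
  under eq_bigr do rewrite mulrA.
  rewrite -mulr_suml [X in X * _](_ : _ = (y *m M) ord0 k); first by rewrite yM mxE mul0r.
  by rewrite mxE; apply: eq_bigr => i' _; rewrite mxE.
have : inner Omega (lincomb (y ord0) e) (e i) = 0.
  rewrite (inner_ae mOmega (V_L2 (lincomb_in _ Ve)) (V_L2 V_0) (V_L2 (Ve i)) lc0).
  exact: inner0.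
rewrite inner_lincomb// (bigD1 i)//= oe eqxx mulr1 big1 ?addr0 ?mxE//.
by move=> j ji; rewrite oe (negbTE ji) mulr0.
Qed.

(** An orthonormal family of maximal length spans V, as a nonzero remainder r
    could be normalized and added to it. *)
Lemma orthonormal_basis : exists m (e : 'I_m -> form), orthonormal_family e /\
  forall v, V v -> ae_eq_form Omega v (lincomb (fun i => inner Omega (e i) v) e).
Proof.
have [d dP] := orthonormal_bound.
pose P m := `[< exists e : 'I_m -> form, orthonormal_family e >].
have exP : exists m, P m.
  exists 0; apply/asboolP; exists (fun _ => 0); split => //; by case.
have ubP m : P m -> (m <= d)%N by move/asboolP => [e /dP].
have [m /asboolP[e [Ve oe]] mmax] := ex_maxnP exP ubP.
exists m, e; split => // v Vv.
pose p := lincomb (fun i => inner Omega (e i) v) e.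
have Vp : V p by exact: lincomb_in.
have hp := V_L2 Vp; have hv := V_L2 Vv.
pose r := v - p; have Vr : V r by rewrite /r subE; exact: V_lin.
have hr := V_L2 Vr.
have re i : inner Omega r (e i) = 0.
  rewrite innerBl//; last exact: V_L2.
  rewrite inner_lincomb// (bigD1 i)//= oe eqxx mulr1 big1.
    by rewrite addr0 innerC subrr.
  by move=> j ji; rewrite oe (negbTE ji) mulr0.
have [r0|r0] := eqVneq (inner Omega r r) 0.
  have := inner_eq0 mOmega hr r0 => H I; have := H I; apply: filterS => x Hx Ox.
  by apply/eqP; rewrite -subr_eq0; apply/eqP; exact: Hx.
have rgt0 : 0 < inner Omega r r by rewrite lt_def r0 inner_ge0.
pose c := (norm2 Omega r)^-1.
have cc : c * (c * inner Omega r r) = 1.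
  by rewrite -norm2_sqr /c expr2; field; rewrite /norm2 sqrtr_eq0 -ltNge.
pose f : form := lin c r 0.
have Vf : V f by exact: V_lin.
have h0 : L2 Omega (0 : form) by exact: V_L2.
pose e' (i : 'I_m.+1) := if unlift ord0 i is Some j then e j else f.
suff : P m.+1 by move/mmax; rewrite ltnn.
apply/asboolP; exists e'; split.
  by move=> i; rewrite /e'; case: unliftP.
have fe i : inner Omega f (e i) = 0.
  by rewrite /f inner_linl//; [rewrite re inner0// mulr0 addr0|exact: V_L2].
have ff : inner Omega f f = 1.
  rewrite /f inner_linl//; last exact: V_L2.
  by rewrite inner_linr// inner0// inner0r// !addr0 cc.
move=> i j; rewrite /e'.
case: (unliftP ord0 i) => [i' ->|->]; case: (unliftP ord0 j) => [j' ->|->].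
- by rewrite oe (inj_eq lift_inj).
- by rewrite innerC fe.
- by rewrite fe.
- by rewrite ff eqxx.
Qed.

(** The Riesz representation theorem, by means of an orthonormal basis. *)
Lemma finite_dimensional_riesz (l : form -> R) :
  (forall a u v, V u -> V v -> l (lin a u v) = a * l u + l v) ->
  (forall u v, V u -> V v -> ae_eq_form Omega u v -> l u = l v) ->
  exists2 w, V w & forall v, V v -> inner Omega w v = l v.
Proof.
move=> llin lae; have [m [e [[Ve oe] eP]]] := orthonormal_basis.
have l0 : l 0 = 0.
  have := llin (-1) _ _ V_0 V_0; rewrite mulN1r addNr.
  by rewrite (_ : lin _ _ _ = 0)//; apply/funext => I; apply/funext => x; rewrite /lin form0E; ring.
exists (lincomb (l \o e) e); first exact: lincomb_in.
move=> v Vv; rewrite inner_lincomb//.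
rewrite (lae _ _ Vv (lincomb_in _ Ve) (eP v Vv)) (functional_lincomb llin l0)//.
by apply: eq_bigr => i _; rewrite /= mulrC.
Qed.
End finite_dimensional_riesz.

(** * The discrete complex *)

Section discrete_estimates.
Context {R : realType} {n : nat}.
Variable (Omega : set 'rV[R]_n).
Hypothesis oOmega : open Omega.
Hypothesis bOmega : bounded_set Omega.
Local Notation mu := (@lebesgue_row R n).
Local Notation form := (dform R n).
Implicit Types (u v w z : form) (k j : nat).

Let mOmega : measurable Omega. Proof. exact: open_row_measurable. Qed.

Lemma HL0_L2 k u : HL0 Omega k u -> L2 Omega u.
Proof. by move/HL0_L2form => -[]. Qed.

Lemma HL0_extd k u : HL0 Omega k u -> is_extd Omega k u (extd Omega k u).
Proof. by move=> [uH _]; exact: extdP. Qed.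

Lemma extd_lin_ae k a u v : HL0 Omega k u -> HL0 Omega k v ->
  ae_eq_form Omega (extd Omega k (lin a u v)) (lin a (extd Omega k u) (extd Omega k v)).
Proof.
move=> uH vH; have hu := HL0_L2 uH; have hv := HL0_L2 vH.
apply: extd_ae => //; first exact: L2_lin.
by apply: is_extd_lin => //; exact: HL0_extd.
Qed.

Lemma extd_congr_ae k u v : HL0 Omega k u -> HL0 Omega k v -> ae_eq_form Omega u v ->
  ae_eq_form Omega (extd Omega k u) (extd Omega k v).
Proof.
move=> uH vH uv; have hu := HL0_L2 uH; have hv := HL0_L2 vH.
apply/ae_eq_form_sym/extd_ae => //.
exact: is_extd_ae uv (HL0_extd uH).
Qed.

Lemma ae_eq_sub0 u v : ae_eq_form Omega u v -> ae_eq_form Omega (lin (-1) u v) 0.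
Proof.
move=> uv I; have := uv I; apply: filterS => x uvx Ox.
by rewrite /lin uvx// mulN1r addNr.
Qed.

Variable (V : nat -> set form).
Hypothesis Vc : discrete_complex Omega V.

Lemma discrete_HL0 k u : (k <= n)%N -> V k u -> HL0 Omega k u.
Proof. exact: dc_conforming. Qed.

Lemma discrete_L2 k u : (k <= n)%N -> V k u -> L2 Omega u.
Proof. by move=> kn /(discrete_HL0 kn)/HL0_L2. Qed.

Lemma discrete_lin k a u v : (k <= n)%N -> V k u -> V k v -> V k (lin a u v).
Proof. by move=> kn; exact: (dc_linear Vc). Qed.

Lemma discrete_codiffP j u : (j.+1 <= n)%N -> V j.+1 u ->
  V j (discrete_codiff Omega V j.+1 u) /\
  forall v, V j v -> inner Omega (discrete_codiff Omega V j.+1 u) v = inner Omega u (extd Omega j v).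
Proof.
move=> jn Vu; have jn' := ltnW jn; have hu := discrete_L2 jn Vu.
have he v : L2 Omega (extd Omega j v) by have [] := L2_extd Omega j v.
have [||||||w Vw wP] := @finite_dimensional_riesz _ _ Omega mOmega (V j) _ _ _ _
    (fun v => inner Omega u (extd Omega j v)).
- by move=> v; exact: discrete_L2.
- exact: (dc_zero Vc).
- by move=> a v v'; exact: discrete_lin.
- exact: (dc_findim Vc).
- move=> a v v' Vv Vv'; rewrite -inner_linr//; apply: inner_aer => //; first exact: L2_lin.
  by apply: extd_lin_ae; exact: discrete_HL0.
- move=> v v' Vv Vv' vv'; apply: inner_aer => //.
  by apply: extd_congr_ae => //; exact: discrete_HL0.
rewrite /discrete_codiff.
by apply: (@xgetPex _ 0 [set w | V j w /\ forall v, V j v -> inner Omega w v = inner Omega u (extd Omega j v)]); exists w.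
Qed.

(** Subtract from v its projection onto the discrete closed forms. *)
Lemma exists_discrete_coclosed j v : (j < n)%N -> V j v ->
  exists phi, [/\ V j phi, ae_eq_form Omega (extd Omega j phi) (extd Omega j v) &
    forall q, V j q -> ae_eq_form Omega (extd Omega j q) 0 -> inner Omega phi q = 0].
Proof.
move=> jn Vv; have jn' := ltnW jn; have hv := discrete_L2 jn' Vv.
pose N : set form := [set q | V j q /\ ae_eq_form Omega (extd Omega j q) 0].
have N0 : N 0.
  split; first exact: (dc_zero Vc).
  apply: extd_ae => //; first exact: L2_0.
  have h0 := dc_zero Vc jn'; apply/is_extd_weakP => //; first exact: L2_0.
  by split; [exact: L2form0|move=> Phi tPhi; rewrite !inner0].
have Nlin a q q' : N q -> N q' -> N (lin a q q').
  move=> [Vq q0] [Vq' q0']; split; first exact: discrete_lin.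
  apply: ae_eq_form_trans (extd_lin_ae a (discrete_HL0 jn' Vq) (discrete_HL0 jn' Vq')) _.
  rewrite [X in ae_eq_form _ _ X](_ : _ = lin a 0 0); first exact: ae_eq_lin.
  by apply/funext => I; apply/funext => x; rewrite /lin form0E; ring.
have [||||p [Vp p0] pP] := @finite_dimensional_riesz _ _ Omega mOmega N _ N0 Nlin _
    (fun q => inner Omega v q).
- by move=> q [Vq _]; exact: discrete_L2 Vq.
- have [m [b bP]] := dc_findim Vc jn'; exists m, b => q [Vq _]; exact: bP.
- by move=> a q q' [Vq _] [Vq' _]; rewrite inner_linr//; apply: discrete_L2 jn' _.
- by move=> q q' [Vq _] [Vq' _] qq'; apply: inner_aer => //; apply: discrete_L2 jn' _.
have hp := discrete_L2 jn' Vp.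
exists (lin (-1) p v); split; first exact: discrete_lin.
- apply: ae_eq_form_trans (extd_lin_ae _ (discrete_HL0 jn' Vp) (discrete_HL0 jn' Vv)) _.
  move=> I; have := p0 I; apply: filterS => x px Ox.
  by rewrite /lin px// form0E mulr0 add0r.
- move=> q Vq q0; have hq := discrete_L2 jn' Vq.
  by rewrite inner_linl// pP// mulN1r addNr.
Qed.

Variable (Pi : nat -> form -> form).
Hypothesis PiP : commuting_projection Omega V Pi.

Lemma projection_discrete k w : (k <= n)%N -> HL0 Omega k w -> V k (Pi k w).
Proof. exact: (cp_range PiP). Qed.

Lemma extd_top u I : extd Omega n u I = cst 0.
Proof.
have [_ ->//] := L2_extd Omega n u.
by rewrite neq_ltn ltnS -[X in (_ <= X)%N](card_ord n) max_card.
Qed.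

(** The projection commutes with d and fixes the discrete form d u, so that it
    does not change the exterior derivative of w when this is discrete. *)
Lemma extd_sub_projection k u w : (k <= n)%N -> V k u -> HL0 Omega k w ->
  ae_eq_form Omega (extd Omega k w) (extd Omega k u) ->
  ae_eq_form Omega (extd Omega k (u - Pi k w)) 0.
Proof.
move=> kn Vu wH dwu; have VPw := projection_discrete kn wH.
have [kn'|nk] := ltnP k n; last first.
  have -> : k = n by apply/eqP; rewrite eqn_leq kn.
  by move=> I; rewrite extd_top; exact: aeW.
rewrite subE.
apply: ae_eq_form_trans (extd_lin_ae _ (discrete_HL0 kn VPw) (discrete_HL0 kn Vu)) _.
apply: ae_eq_sub0.
have Vdu := dc_complex Vc kn' Vu.
have Vdw : V k.+1 (extd Omega k w).
  apply: (dc_ae Vc) Vdu _ _ => //; first exact: L2_extd.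
  exact: ae_eq_form_sym.
apply: ae_eq_form_trans (cp_commute PiP kn' wH) _.
exact: ae_eq_form_trans (cp_id PiP kn' Vdw) dwu.
Qed.

Lemma sub_projection_discrete k u w : (k <= n)%N -> V k u -> HL0 Omega k w -> V k (u - Pi k w).
Proof. by move=> kn Vu wH; rewrite subE; apply: discrete_lin => //; exact: projection_discrete. Qed.

(** The form q = phi - Pi z is closed and discrete, so that phi, orthogonal to the
    discrete closed forms, and z, orthogonal to the closed forms of zero trace,
    are both orthogonal to it. Hence phi - z is orthogonal to q, and its norm is
    at most that of its difference with q. *)
Lemma discrete_coclosed_estimate j phi z : (j < n)%N -> V j phi ->
  (forall q, V j q -> ae_eq_form Omega (extd Omega j q) 0 -> inner Omega phi q = 0) ->
  HL0 Omega j z -> ae_eq_form Omega (extd Omega j z) (extd Omega j phi) ->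
  (forall q, L2form Omega j q ->
    (forall v, Hstar Omega j.+1 v -> inner Omega q (codiff Omega j.+1 v) = 0) ->
    inner Omega z q = 0) ->
  norm2 Omega (phi - z) <= norm2 Omega (z - Pi j z).
Proof.
move=> jn Vphi phio zH dz zo; have jn' := ltnW jn.
have VPz := projection_discrete jn' zH.
have hphi := discrete_L2 jn' Vphi; have hz := HL0_L2 zH; have hPz := discrete_L2 jn' VPz.
pose q := phi - Pi j z.
have Vq : V j q by exact: sub_projection_discrete.
have q0 : ae_eq_form Omega (extd Omega j q) 0 by exact: extd_sub_projection.
have hq := discrete_L2 jn' Vq; have hpz : L2 Omega (phi - z) by exact: L2B.
have hzP : L2 Omega (z - Pi j z) by exact: L2B.
have o : inner Omega (phi - z) q = 0.
  rewrite innerBl// phio// zo ?subrr//; first exact: HL0_L2form (discrete_HL0 jn' Vq).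
  by apply: closed_orthogonal_codiff => //; exact: discrete_HL0.
have E : inner Omega (phi - z) (phi - z) = - inner Omega (phi - z) (z - Pi j z).
  rewrite -[LHS](subr0) -o -innerBr//.
  rewrite (_ : phi - z - q = lin (-1) (z - Pi j z) 0); last first.
    by apply/funext => I; apply/funext => x; rewrite /q /lin !fctE/= form0E; lra.
  by rewrite inner_linr ?inner0r// ?addr0 ?mulN1r//; exact: L2_0.
have := norm2_sqr Omega (phi - z); rewrite E.
have := inner_le mOmega hpz hzP.
have := norm2_ge0 Omega (phi - z); have := norm2_ge0 Omega (z - Pi j z).
move: (norm2 _ _) (norm2 _ _) (inner _ _ _) => b a c a0 b0 cab bc.
have {}cab : b ^+ 2 <= b * a by rewrite bc (le_trans (ler_norm _))// normrN.
have [->//|bn0] := eqVneq b 0.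
by rewrite -(ler_pM2l (_ : 0 < b)) -?expr2// lt_def bn0.
Qed.

End discrete_estimates.

(** * The error estimate *)

Section hodge_mapping_estimate.
Context {R : realType} {n : nat}.
Variable (Omega : set 'rV[R]_n).
Hypothesis oOmega : open Omega.
Hypothesis bOmega : bounded_set Omega.
Local Notation form := (dform R n).
Implicit Types (u v w z : form) (k j : nat).

Let mOmega : measurable Omega. Proof. exact: open_row_measurable. Qed.

(** With P = 2 p + q the assumptions give a^2 <= P t a + (P t)^2, which fails for
    a > 2 P t. *)
Lemma quadratic_bound (a b d t p q : R) : 0 <= a -> 0 <= d -> d <= t -> 0 <= p -> 0 <= q ->
  b <= q * t -> a ^+ 2 <= a * b + 2 * p * d * (a + b) -> a <= 2 * (2 * p + q) * t.
Proof.
move=> a0 d0 dt p0 q0 bq A; have t0 := le_trans d0 dt.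
set P := 2 * p + q; have P0 : 0 <= P by rewrite /P; lra.
have pP : 2 * p <= P by rewrite /P; lra.
have qP : q <= P by rewrite /P; lra.
have A1 : a ^+ 2 <= a * (q * t) + 2 * p * t * (a + q * t).
  apply: le_trans A _; apply: lerD; first exact: ler_wpM2l.
  have [ab|ab] := leP 0 (a + b).
    apply: le_trans (_ : 2 * p * t * (a + b) <= _).
      by rewrite ler_wpM2r// ler_wpM2l// mulr_ge0.
    by rewrite ler_wpM2l ?lerD2l// !mulr_ge0.
  apply: le_trans (_ : 0 <= _); last by rewrite !(mulr_ge0, addr_ge0).
  by rewrite mulr_ge0_le0 ?mulr_ge0// ltW.
have A2 : a ^+ 2 <= P * t * a + (P * t) ^+ 2.
  apply: le_trans A1 _; rewrite (_ : _ + _ = P * t * a + (2 * p * t) * (q * t)); last by rewrite /P; ring.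
  by rewrite lerD2l expr2 ler_pM// ?mulr_ge0// ler_wpM2r.
rewrite -mulrA; set T := P * t in A2 *; have T0 : 0 <= T by rewrite mulr_ge0.
rewrite leNgt; apply/negP => ta; nra.
Qed.

Variable (V : nat -> set form).
Hypothesis Vc : discrete_complex Omega V.
Variable (Pi : nat -> form -> form).
Hypothesis PiP : commuting_projection Omega V Pi.

(** The assumption says that the codifferential of w is orthogonal to its
    difference with D. *)
Lemma Zspace_norm_codiff k w D : Zspace Omega k w -> L2 Omega D ->
  inner Omega (codiff Omega k w) (codiff Omega k w) = inner Omega D (codiff Omega k w) ->
  norm2 Omega (codiff Omega k w) <= norm2 Omega D.
Proof.
move=> wZ hD E; have [hc _] := L2_codiff Omega k w.
have := norm2_sqr Omega (codiff Omega k w); rewrite E.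
have := inner_le mOmega hD hc.
have := norm2_ge0 Omega D; have := norm2_ge0 Omega (codiff Omega k w).
move: (norm2 _ (codiff _ _ _)) (norm2 _ D) (inner _ _ _) => b a c b0 a0 cab bc.
have {}cab : b ^+ 2 <= b * a by rewrite bc (le_trans (ler_norm _))// mulrC.
have [->//|bn0] := eqVneq b 0.
by rewrite -(ler_pM2l (_ : 0 < b)) -?expr2// lt_def bn0.
Qed.

(** The estimate in positive degree, assuming the error bounds p t and q t for
    the projections on the spaces Z of degrees j and j + 1. *)
Lemma hodge_mapping_estimate j (Hk : form -> form) u (t p q : R) :
  (j < n)%N -> 0 <= t -> 0 <= p -> 0 <= q ->
  (forall z, Zspace Omega j z -> norm2 Omega (z - Pi j z) <=
     p * t * (norm2 Omega (extd Omega j z) + norm2 Omega (codiff Omega j z))) ->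
  (forall z, Zspace Omega j.+1 z -> norm2 Omega (z - Pi j.+1 z) <=
     q * t * (norm2 Omega (extd Omega j.+1 z) + norm2 Omega (codiff Omega j.+1 z))) ->
  hodge_mapping Omega V j.+1 Hk -> V j.+1 u ->
  norm2 Omega (u - Hk u) <= 2 * (2 * p + q) * (t *
     (norm2 Omega (extd Omega j.+1 u) + norm2 Omega (discrete_codiff Omega V j.+1 u))).
Proof.
move=> jn t0 p0 q0 Pj Pk HkP Vu; have jn' := ltnW jn.
have [wZ dw cw] := HkP u Vu; move: (Hk u) wZ dw cw => w wZ dw cw {HkP Hk}.
have [wH wHs] := wZ.
set D := discrete_codiff _ _ _ _ in cw *.
have [VD DP] : V j D /\ _ := discrete_codiffP oOmega bOmega Vc jn Vu.
have hD := discrete_L2 Vc jn' VD; have hu := discrete_L2 Vc jn Vu; have hw := HL0_L2 wH.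
have kc := L2form_codiff Omega j w; have [hc _] := kc.
have hPw := discrete_L2 Vc jn (projection_discrete PiP jn wH).
have [heu _] := L2_extd Omega j.+1 u; have [hew _] := L2_extd Omega j.+1 w.
have codiff_le : norm2 Omega (codiff Omega j.+1 w) <= norm2 Omega D.
  by apply: Zspace_norm_codiff => //; exact: cw.
(* The closed discrete form u - Pi w has a discrete potential phi. *)
have Vr := sub_projection_discrete Vc PiP jn Vu wH.
have r0 := extd_sub_projection oOmega bOmega Vc PiP jn Vu wH dw.
have [v [Vv dv]] := dc_exact Vc jn Vr r0.
have [phi [Vphi dphi phio]] := exists_discrete_coclosed oOmega bOmega Vc jn Vv.
have phiH := discrete_HL0 Vc jn' Vphi; have hphi := HL0_L2 phiH.
have {dv}dphi := ae_eq_form_trans dphi dv.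
have [z [zZ dz cz zo phizo]] := coclosed_representative oOmega bOmega jn phiH.
have [zH _] := zZ; have hz := HL0_L2 zH.
have [hephi _] := L2_extd Omega j phi; have [hez _] := L2_extd Omega j z.
have hr : L2 Omega (u - Pi j.+1 w) by exact: L2B.
have huw : L2 Omega (u - w) by exact: L2B.
have hPww : L2 Omega (w - Pi j.+1 w) by exact: L2B.
have hpz : L2 Omega (phi - z) by exact: L2B.
(* The residual f is closed with zero trace, hence orthogonal to z. *)
pose f := D - codiff Omega j.+1 w.
have hf : L2 Omega f by exact: L2B.
have fz : inner Omega z f = 0.
  apply: zo; first by apply: L2formB => //; exact: HL0_L2form (discrete_HL0 Vc jn' VD).
  move=> v' v'H; have [hcv _] := L2form_codiff Omega j v'.
  have [z' [z'Z cz']] := codiff_Zspace oOmega bOmega jn v'H.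
  have [hcz _] := L2form_codiff Omega j z'.
  by rewrite -(inner_aer mOmega hcz hcv hf cz') innerBl// cw// subrr.
(* Split u - w along u - Pi w = d phi; both the discrete codifferential of u and
   the codifferential of w are adjoint to d on phi. *)
have E : inner Omega (u - w) (u - w) =
    inner Omega f (phi - z) - inner Omega (u - w) (w - Pi j.+1 w).
  transitivity (inner Omega (u - w) (u - Pi j.+1 w) - inner Omega (u - w) (w - Pi j.+1 w)).
    rewrite -innerBr//; congr inner.
    by apply/funext => I; apply/funext => x; rewrite !fctE/=; lra.
  congr (_ - _); rewrite -(inner_aer mOmega hephi hr huw dphi) innerBl// -DP//.
  rewrite [X in _ - X]innerC (HL0_boundary jn phiH wHs) [X in _ - X]innerC.
  by rewrite -innerBl// -/f innerBr// [X in _ - X]innerC fz subr0.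
have phiz : norm2 Omega (phi - z) <= norm2 Omega (z - Pi j z).
  exact: discrete_coclosed_estimate phio zH dz zo.
have nphi : norm2 Omega (extd Omega j phi) <= norm2 Omega (u - w) + norm2 Omega (w - Pi j.+1 w).
  rewrite (norm2_ae mOmega hephi hr dphi).
  rewrite (_ : u - _ = lin 1 (u - w) (w - Pi j.+1 w)); first exact: norm2D.
  by apply/funext => I; apply/funext => x; rewrite /lin !fctE/=; lra.
have zerr := Pj _ zZ; have werr := Pk _ wZ.
have hcz : L2 Omega (codiff Omega j z) by have [] := L2_codiff Omega j z.
rewrite (norm2_ae mOmega hez hephi dz) (norm2_ae mOmega hcz (L2_0 _) cz) in zerr.
rewrite (norm2_ae mOmega hew heu dw) in werr.
have n0 : norm2 Omega (0 : form) = 0 by rewrite /norm2 inner0// sqrtr0.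
rewrite n0 addr0 in zerr.
have nf : norm2 Omega f <= 2 * norm2 Omega D.
  by apply: le_trans (norm2B mOmega hD hc) _; rewrite mulr_natl mulr2n lerD2l.
apply: (@quadratic_bound _ (norm2 Omega (w - Pi j.+1 w)) (t * norm2 Omega D)) => //.
- exact: norm2_ge0.
- by rewrite mulr_ge0// norm2_ge0.
- by rewrite ler_wpM2l// lerDr norm2_ge0.
- apply: le_trans werr _; rewrite mulrA ler_wpM2l ?lerD2l//.
  by rewrite mulr_ge0.
rewrite norm2_sqr E.
have c1 := inner_le mOmega hf hpz; have c2 := inner_le mOmega huw hPww.
rewrite addrC; apply: lerD.
  by apply: le_trans c2; rewrite -normrN ler_norm.
apply: le_trans (ler_norm _) _; apply: le_trans c1 _.
apply: le_trans (_ : (2 * norm2 Omega D) * (p * t * norm2 Omega (extd Omega j phi)) <= _).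
  apply: ler_pM => //; [exact: norm2_ge0|exact: norm2_ge0|exact: le_trans phiz zerr].
rewrite (_ : _ * (p * t * _) = 2 * p * (t * norm2 Omega D) * norm2 Omega (extd Omega j phi)); last by ring.
by rewrite ler_wpM2l// !mulr_ge0// norm2_ge0.
Qed.

(** In degree 0 the only closed discrete form is 0, so that u is the projection of
    its image under the Hodge mapping. *)
Lemma hodge_mapping_estimate0 (Hk : form -> form) u (t q : R) :
  0 <= t -> 0 <= q ->
  (forall z, Zspace Omega 0 z -> norm2 Omega (z - Pi 0 z) <=
     q * t * (norm2 Omega (extd Omega 0 z) + norm2 Omega (codiff Omega 0 z))) ->
  hodge_mapping Omega V 0 Hk -> V 0 u ->
  norm2 Omega (u - Hk u) <= q * (t * norm2 Omega (extd Omega 0 u)).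
Proof.
move=> t0 q0 Pk HkP Vu.
have [wZ dw cw] := HkP u Vu; move: (Hk u) wZ dw cw => w wZ dw cw {HkP Hk}.
have [wH wHs] := wZ.
have hu := discrete_L2 Vc (leq0n n) Vu; have hw := HL0_L2 wH.
have hPw := discrete_L2 Vc (leq0n n) (projection_discrete PiP (leq0n n) wH).
have [heu _] := L2_extd Omega 0 u; have [hew _] := L2_extd Omega 0 w.
have r0 := extd_sub_projection oOmega bOmega Vc PiP (leq0n n) Vu wH dw.
have ur := dc_exact Vc (leq0n n) (sub_projection_discrete Vc PiP (leq0n n) Vu wH) r0.
have c0 : codiff Omega 0 w = 0.
  by have [_ kc] := L2_codiff Omega 0 w; apply/funext => I; rewrite kc.
have n0 : norm2 Omega (0 : form) = 0 by rewrite /norm2 inner0// sqrtr0.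
have := Pk _ wZ; rewrite c0 n0 addr0 (norm2_ae mOmega hew heu dw) -mulrA.
apply: le_trans; rewrite le_eqVlt; apply/orP; left; apply/eqP.
have hPww : L2 Omega (w - Pi 0 w) by exact: L2B.
rewrite -[RHS](norm2N mOmega)//; apply: norm2_ae => //.
- exact: L2B.
- by apply: L2_lin => //; exact: L2_0.
- move=> I; have := ur I; apply: filterS => x /[apply].
  by rewrite /lin !fctE/= form0E => H; lra.
Qed.

(** Regularity turns the approximation property of the projections into an
    error bound by the exterior derivative and the codifferential. *)
Lemma projection_error s k (Mesh : Type) (h : Mesh -> R) (Pis : Mesh -> nat -> form -> form) :
  s_regular Omega s -> uniform_bounds Omega h s Pis -> (k <= n)%N ->
  exists C, 0 <= C /\ forall i z, Zspace Omega k z ->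
    norm2 Omega (z - Pis i k z) <=
    C * h i `^ s * (norm2 Omega (extd Omega k z) + norm2 Omega (codiff Omega k z)).
Proof.
move=> reg ub kn; have [A AP] := reg k kn; have [B BP] := ub_approx ub kn.
exists (`|B| * Num.sqrt `|A|); split; first by rewrite mulr_ge0// sqrtr_ge0.
move=> i z zZ; have [zs nz] := AP _ zZ; have [zH _] := zZ.
have hs0 : 0 <= h i `^ s by exact: powR_ge0.
apply: le_trans (BP i _ zH zs) _.
have a0 := norm2_ge0 Omega (extd Omega k z); have b0 := norm2_ge0 Omega (codiff Omega k z).
move: (norm2 _ (extd _ _ _)) (norm2 _ (codiff _ _ _)) a0 b0 nz => a b a0 b0 nz.
have N0 : 0 <= normHs Omega s z by exact: sqrtr_ge0.
have nle : normHs Omega s z <= Num.sqrt `|A| * (a + b).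
  rewrite -(ler_pXn2r (n := 2))// ?nnegrE ?mulr_ge0 ?sqrtr_ge0 ?addr_ge0//.
  apply: le_trans nz _; rewrite exprMn sqr_sqrtr//.
  apply: le_trans (_ : `|A| * (a ^+ 2 + b ^+ 2) <= _).
    by rewrite ler_wpM2r ?ler_norm// addr_ge0// sqr_ge0.
  by rewrite ler_wpM2l//; nra.
apply: le_trans (_ : `|B| * h i `^ s * normHs Omega s z <= _).
  by rewrite ler_wpM2r// ler_wpM2r// ler_norm.
rewrite (_ : `|B| * Num.sqrt `|A| * h i `^ s * (a + b) = `|B| * h i `^ s * (Num.sqrt `|A| * (a + b))).
  by rewrite ler_wpM2l// mulr_ge0.
by ring.
Qed.
End hodge_mapping_estimate.

Theorem theorem5 (R : realType) (n : nat) (n_gt0 : (0 < n)%N)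
    (Omega : set 'rV[R]_n) (s : R)
    (Omega_domain : bounded_domain Omega)
    (Omega_cohomology : trivial_cohomology Omega)
    (s_range : 2^-1 <= s <= 1)
    (Omega_regular : s_regular Omega s)
    (Mesh : Type) (h : Mesh -> R) (h_gt0 : forall i, 0 < h i)
    (V : Mesh -> nat -> set (dform R n))
    (V_complex : forall i, discrete_complex Omega (V i))
    (Pi : Mesh -> nat -> dform R n -> dform R n)
    (Pi_projection : forall i, commuting_projection Omega (V i) (Pi i))
    (Pi_bounds : uniform_bounds Omega h s Pi)
    (k : nat) (k_le_n : (k <= n)%N) :
  exists C : R, 0 < C /\
    forall (i : Mesh) (Hk : dform R n -> dform R n),
      hodge_mapping Omega (V i) k Hk ->
    forall u : dform R n, V i k u ->
      norm2 Omega (u - Hk u) <=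
      C * h i `^ s *
        (norm2 Omega (extd Omega k u) +
         norm2 Omega (discrete_codiff Omega (V i) k u)).
Proof.
have [_ oO _ bO] := Omega_domain.
have hs0 i : 0 <= h i `^ s by exact: powR_ge0.
have [q [q0 qP]] := projection_error Omega_regular Pi_bounds k_le_n.
case: k => [|j] in k_le_n qP *.
  exists (q + 1); split; first by rewrite ltr_wpDl.
  move=> i Hk HkP u Vu.
  apply: le_trans (hodge_mapping_estimate0 oO bO (V_complex i) (Pi_projection i)
    (hs0 i) q0 (qP i) HkP Vu) _.
  rewrite mulrA; apply: ler_pM; rewrite ?mulr_ge0 ?norm2_ge0//.
    by rewrite ler_wpM2r// lerDl.
  by rewrite lerDl norm2_ge0.
have [p [p0 pP]] := projection_error Omega_regular Pi_bounds (ltnW k_le_n).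
exists (2 * (2 * p + q) + 1); split; first by rewrite ltr_wpDl// !(mulr_ge0, addr_ge0).
move=> i Hk HkP u Vu.
apply: le_trans (hodge_mapping_estimate oO bO (V_complex i) (Pi_projection i)
  k_le_n (hs0 i) p0 q0 (pP i) (qP i) HkP Vu) _.
rewrite mulrA ler_wpM2r ?addr_ge0 ?norm2_ge0// ler_wpM2r// lerDl.
by [].
Qed.
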